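(* For every integer $n\ge 1$, the map $\Phi:\mathrm{VHC}(S_{n-1})\to\widetilde{\mathcal P}^c(n)$ (defined in the context) is a bijection.
   Context: Valid hook configurations. $S_n$ is the set of permutations of $\{1,\ldots,n\}$, written $\pi=\pi_1\cdots\pi_n$ ($S_0$ consists of the empty permutation). A descent of $\pi$ is an index $i\in\{1,\ldots,n-1\}$ with $\pi_i>\pi_{i+1}$. The plot of $\pi$ is the set of points $(i,\pi_i)$. A hook of $\pi$ is given by a southwest endpoint $(i,\pi_i)$ and a northeast endpoint $(j,\pi_j)$ with $i<j$ and $\pi_i<\pi_j$; it is the L-shaped set $(\{i\}\times[\pi_i,\pi_j])\cup([i,j]\times\{\pi_j\})$. If $\pi$ has descents $d_1<\cdots<d_k$, a valid hook configuration of $\pi$ is a tuple $\mathcal H=(H_1,\ldots,H_k)$ of hooks of $\pi$ such that: (1) for each $i$, the southwest endpoint of $H_i$ is $(d_i,\pi_{d_i})$; (2) no point of the plot lies directly above a hook (i.e., if a hook has endpoints $(i,\pi_i)$ and $(j,\pi_j)$ and $i<l<j$, then $\pi_l<\pi_j$); (3) hooks do not intersect each other, except that the northeast endpoint of one hook may be the southwest endpoint of another. $\mathrm{VHC}(\pi)$ is the set of valid hook configurations of $\pi$, and $\mathrm{VHC}(S_{n-1})=\bigcup_{\pi\in S_{n-1}}\mathrm{VHC}(\pi)$ (a disjoint union; a configuration carries its underlying permutation). Set partitions. For a partition $\rho$ of $\{1,\ldots,n\}$, two distinct blocks $B,B'$ form a crossing if there are $i,k\in B$ and $j,\ell\in B'$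 with $i<j<k<\ell$ or $i>j>k>\ell$. The crossing graph $G(\rho)$ has the blocks of $\rho$ as vertices, two blocks being adjacent iff they form a crossing. $\widetilde{\mathcal P}^c(n)$ is the set of pairs $(\rho,\alpha)$ where $\rho$ is a partition of $\{1,\ldots,n\}$ with $G(\rho)$ connected and $\alpha$ is an acyclic orientation of $G(\rho)$ whose only source (vertex of in-degree $0$) is the block containing $n$. The map $\Phi$. Let $\mathcal H\in\mathrm{VHC}(\pi)$ with $\pi\in S_{n-1}$. Draw a blue ''sky'' above the plot and give the hooks distinct colors other than blue. A point $(l,\pi_l)$ that is not a northeast endpoint of a hook looks directly upward and gets the color of the first hook it sees, or blue if it sees no hook; a southwest endpoint of a hook looks around (on the left side of) the vertical part of that hook, so it does not see its own hook. (That is: among hooks with endpoints $(d,\pi_d)$, $(j,\pi_j)$ satisfying $d<l<j$, take the one with smallest $\pi_j$; the color is that hook's color, or blue if there is no such hook.) The northeast endpoint of a hook gets the color of that hook. Color $\pi_i$ like the point $(i,\pi_i)$, and color $n$ blue; this gives a partition $\rho$ of $\{1,\ldots,n\}$ into color classes. For a block $B$ let $\widehat B=\{i:1\le i\le n-1,\ \pi_i\in B\}$. Orient each edge of $G(\rho)$ between $B$ and $B'$ from $B$ to $B'$ if $\min\widehat B<\min\widehat{B'}$ and from $B'$ to $B$ otherwise; call this orientation $\alpha$. Then $\Phi(\mathcal H)=(\rho,\alpha)$. *)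

(* Defs.v *)
From mathcomp Require Import all_boot all_order all_algebra all_fingroup.
From mathcomp Require Import classical_sets functions set_interval reals.

Set Implicit Arguments.
Unset Strict Implicit.
Unset Printing Implicit Defensive.

(* Indices and values are shifted down by one: {1, ..., m} is 'I_m.  With
   n = m.+1, the set {1, ..., n} is 'I_m.+1, the element n is ord_max, and the
   inclusion of {1, ..., n - 1} into {1, ..., n} is lift ord_max. *)

(* A hook of a permutation is recorded by the positions (i, j) of its southwest
   and northeast endpoints. *)
Definition hook (m : nat) : predArgType := ('I_m * 'I_m)%type.

Definition descent m (pi : 'S_m) (i : 'I_m) : bool :=
  [exists j : 'I_m, (val j == (val i).+1) && (pi j < pi i)].

Definition descents m (pi : 'S_m) : seq 'I_m :=
  [seq i <- enum 'I_m | descent pi i].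

Definition is_hook m (pi : 'S_m) (h : hook m) : bool :=
  (h.1 < h.2) && (pi h.1 < pi h.2).

Definition plot_point (R : realType) m (pi : 'S_m) (i : 'I_m) : R * R :=
  ((val i)%:R, (val (pi i))%:R)%R.

Definition hook_points (R : realType) m (pi : 'S_m) (h : hook m) : set (R * R) :=
  let a := plot_point R pi h.1 in
  let b := plot_point R pi h.2 in
  (([set a.1] `*` `[a.2, b.2]) `|` (`[a.1, b.1] `*` [set b.2]))%classic.

Definition no_point_above m (pi : 'S_m) (h : hook m) : Prop :=
  forall l : 'I_m, h.1 < l < h.2 -> pi l < pi h.2.

Definition meet_only_at_endpoints (R : realType) m (pi : 'S_m) (h h' : hook m) :
    Prop :=
  forall p : R * R, hook_points pi h p -> hook_points pi h' p ->
    (p = plot_point R pi h.2 /\ p = plot_point R pi h'.1) \/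
    (p = plot_point R pi h.1 /\ p = plot_point R pi h'.2).

(* The equation on southwest endpoints also forces H to have exactly one hook
   per descent, listed in the order of the descents. *)
Definition VHC (R : realType) m (pi : 'S_m) : set (seq (hook m)) :=
  [set H | [/\ map fst H = descents pi,
               (forall h, h \in H -> is_hook pi h),
               (forall h, h \in H -> no_point_above pi h) &
               (forall h h', h \in H -> h' \in H -> h != h' ->
                  meet_only_at_endpoints R pi h h')]]%classic.

Definition VHCS (R : realType) m : set ('S_m * seq (hook m)) :=
  [set c | VHC R c.1 c.2]%classic.

Definition crossing n (B B' : {set 'I_n}) : bool :=
  [exists i in B, exists k in B, exists j in B', exists l in B',
     [&& i < j, j < k & k < l] || [&& i > j, j > k & k > l]].

Definition crossing_graph n (rho : {set {set 'I_n}}) : rel {set 'I_n} :=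
  fun B B' => [&& B \in rho, B' \in rho, B != B' & crossing B B'].

Definition crossing_graph_connected n (rho : {set {set 'I_n}}) : Prop :=
  forall B B', B \in rho -> B' \in rho -> connect (crossing_graph rho) B B'.

(* An orientation is the set of its arcs (tail, head). *)
Definition arcs (n : nat) : predArgType := {set {set 'I_n} * {set 'I_n}}.

Definition is_orientation n (rho : {set {set 'I_n}}) (alpha : arcs n) : Prop :=
  (forall B B', (B, B') \in alpha -> crossing_graph rho B B') /\
  (forall B B', crossing_graph rho B B' ->
     ((B, B') \in alpha) (+) ((B', B) \in alpha)).

Definition acyclic n (alpha : arcs n) : Prop :=
  forall c : seq {set 'I_n}, path.cycle (fun B B' => (B, B') \in alpha) c -> c = [::].

Definition indegree n (alpha : arcs n) (B : {set 'I_n}) : nat :=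
  #|[set B' | (B', B) \in alpha]%SET|.

Definition sources n (rho : {set {set 'I_n}}) (alpha : arcs n) :
    {set {set 'I_n}} :=
  [set B in rho | indegree alpha B == 0]%SET.

Definition Ptilde_c m : set ({set {set 'I_m.+1}} * arcs m.+1) :=
  [set ra | [/\ finset.partition ra.1 [set: 'I_m.+1]%SET,
                crossing_graph_connected ra.1,
                is_orientation ra.1 ra.2,
                acyclic ra.2 &
                sources ra.1 ra.2 = [set finset.pblock ra.1 ord_max]%SET]]%classic.

(* The color of a hook is the hook itself (as Some h); None is blue. *)
Definition sees m (l : 'I_m) (h : hook m) : bool := h.1 < l < h.2.

Definition first_seen m (pi : 'S_m) (H : seq (hook m)) (l : 'I_m) :
    option (hook m) :=
  [pick h in H | sees l h &&
     [forall (h' | (h' \in H) && sees l h'), pi h.2 <= pi h'.2]].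

Definition point_color m (pi : 'S_m) (H : seq (hook m)) (l : 'I_m) :
    option (hook m) :=
  if [pick h in H | h.2 == l] is Some h then Some h else first_seen pi H l.

Definition value_color m (pi : 'S_m) (H : seq (hook m)) (v : 'I_m.+1) :
    option (hook m) :=
  if unlift ord_max v is Some u then point_color pi H (pi^-1%g u) else None.

Definition color_partition m (pi : 'S_m) (H : seq (hook m)) :
    {set {set 'I_m.+1}} :=
  preim_partition (value_color pi H) [set: 'I_m.+1]%SET.

Definition hat m (pi : 'S_m) (B : {set 'I_m.+1}) : {set 'I_m} :=
  [set i | lift ord_max (pi i) \in B]%SET.

(* The default value m only concerns B = {n}, which crosses no block. *)
Definition min_hat m (pi : 'S_m) (B : {set 'I_m.+1}) : nat :=
  \big[minn/m]_(i in hat pi B) val i.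

(* Distinct blocks other than {n} have distinct values of min_hat, so each edge
   receives exactly one direction. *)
Definition color_orientation m (pi : 'S_m) (H : seq (hook m)) : arcs m.+1 :=
  [set e | crossing_graph (color_partition pi H) e.1 e.2
           && (min_hat pi e.1 < min_hat pi e.2)]%SET.

Definition Phi m (c : 'S_m * seq (hook m)) : {set {set 'I_m.+1}} * arcs m.+1 :=
  (color_partition c.1 c.2, color_orientation c.1 c.2).

(* Main.v *)
(* Reading a permutation from left to right, the colors behave like a stack: a
   descent pushes the color of its hook, and the maximum of a block pops that
   block.  Hence a configuration amounts to the order in which the blocks are
   pushed (the order of [min_hat]), and an order of the blocks of [rho] occurs
   exactly when each block without n, on arrival, straddles an entry that is
   still on the stack ([good_order]).  For an acyclic orientation of the
   crossing graph whose only source is the block of n, the good orders that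
   induce it are its lexicographically least linear extensions, where blocks
   are compared by their maxima; so there is exactly one. *)
Require Import Defs.
From mathcomp Require Import all_boot all_order all_algebra all_fingroup.
From mathcomp Require Import classical_sets functions set_interval reals.
From mathcomp Require Import zify.

Set Implicit Arguments.
Unset Strict Implicit.
Unset Printing Implicit Defensive.

(** * Orders on the blocks of a partition *)

(** Goodness speaks of straddling, not of crossing; [good_order_threshold] is the bridge. It shows
    that in a good order each block without n crosses an earlier one, whence connectedness and the
    unique source. It also shows that two good orders with the same orientation cannot disagree,
    without comparing either of them with the greedy one. Once the order is known nothing is left to
    choose: [reading_order] describes the permutation by the partition and the order alone, and each
    hook runs from just before the least entry of its block to the greatest one. *)

Lemma argmin_exists (T : finType) (P : pred T) (f : T -> nat) x :
  P x -> exists2 y, P y & forall z, P z -> f y <= f z.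
Proof. by move=> Px; case: (arg_minnP f Px) => y Py ymin; exists y. Qed.

Lemma argmax_exists (T : finType) (P : pred T) (f : T -> nat) x :
  P x -> exists2 y, P y & forall z, P z -> f z <= f y.
Proof. by move=> Px; case: (arg_maxnP f Px) => y Py ymax; exists y. Qed.

Lemma crossingP n (B B' : {set 'I_n}) :
  reflect (exists i k j l, [/\ i \in B, k \in B, j \in B', l \in B' &
             [&& i < j, j < k & k < l] || [&& i > j, j > k & k > l]])
          (crossing B B').
Proof.
rewrite /crossing; apply: (iffP idP).
  move=> /exists_inP[i iB /exists_inP[k kB]].
  by move=> /exists_inP[j jB /exists_inP[l lB H]]; exists i, k, j, l.
move=> [i [k [j [l [iB kB jB lB H]]]]].
apply/exists_inP; exists i => //; apply/exists_inP; exists k => //.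
by apply/exists_inP; exists j => //; apply/exists_inP; exists l.
Qed.

Section Extrema.
Variable m : nat.
Implicit Type B : {set 'I_m.+1}.

(** The base point of [arg min] has to lie in the set, so it is picked from [B]; [ord0] only
    concerns the empty set. *)
Definition lo B : 'I_m.+1 :=
  [arg min_(i < odflt ord0 [pick x in B] | i \in B) val i].

Definition hi B : 'I_m.+1 :=
  [arg max_(i > odflt ord0 [pick x in B] | i \in B) val i].

Lemma loP B x : x \in B -> lo B \in B /\ (forall z, z \in B -> lo B <= z).
Proof.
move=> xB; rewrite /lo; case: pickP => [y yB|/(_ x)]; last by rewrite xB.
by case: arg_minnP => //= i iB imin; split.
Qed.

Lemma hiP B x : x \in B -> hi B \in B /\ (forall z, z \in B -> z <= hi B).
Proof.
move=> xB; rewrite /hi; case: pickP => [y yB|/(_ x)]; last by rewrite xB.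
by case: arg_maxnP => //= i iB imin; split.
Qed.

Lemma lo_le B x : x \in B -> lo B <= x.
Proof. by move=> xB; apply: (loP xB).2. Qed.

Lemma hi_ge B x : x \in B -> x <= hi B.
Proof. by move=> xB; apply: (hiP xB).2. Qed.

Lemma crossing_sym B B' : crossing B B' = crossing B' B.
Proof.
apply/crossingP/crossingP => -[i [k [j [l [iB kB jB lB H]]]]];
  by exists l, j, k, i; split=> //; lia.
Qed.

Lemma crossing_hull B B' y z x w : y \in B -> z \in B -> x \in B' -> w \in B' ->
  y < x < z -> ~~ (y <= w <= z) -> crossing B B'.
Proof.
move=> yB zB xB wB yxz wyz; apply/crossingP; have [zw|wz] := ltnP z w.
  by exists y, z, x, w; split=> //; lia.
by exists z, y, x, w; split=> //; lia.
Qed.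

End Extrema.

Section Blocks.
Variables (m : nat) (rho : {set {set 'I_m.+1}}).
Hypothesis rhoP : finset.partition rho [set: 'I_m.+1]%SET.
Local Notation blk := (finset.pblock rho).

Lemma blk_in v : blk v \in rho.
Proof.
by case/and3P: rhoP => /eqP cov _ _; rewrite finset.pblock_mem // cov inE.
Qed.

Lemma mem_blk v : v \in blk v.
Proof.
by case/and3P: rhoP => /eqP cov _ _; rewrite finset.mem_pblock cov inE.
Qed.

Lemma blk_eq B v : B \in rho -> v \in B -> blk v = B.
Proof. by case/and3P: rhoP => _ tI _; apply: finset.def_pblock. Qed.

Lemma block_inhabited B : B \in rho -> exists x, x \in B.
Proof.
case/and3P: rhoP => _ _ n0 Br; apply/set0Pn; apply: contraNneq n0 => <-.
by [].
Qed.

Lemma lo_in B : B \in rho -> lo B \in B.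
Proof. by case/block_inhabited=> x /loP[]. Qed.

Lemma hi_in B : B \in rho -> hi B \in B.
Proof. by case/block_inhabited=> x /hiP[]. Qed.

Lemma blk_lo B : B \in rho -> blk (lo B) = B.
Proof. by move=> Br; apply: blk_eq => //; apply: lo_in. Qed.

Lemma blk_hi B : B \in rho -> blk (hi B) = B.
Proof. by move=> Br; apply: blk_eq => //; apply: hi_in. Qed.

Lemma hi_inj B B' : B \in rho -> B' \in rho -> hi B = hi B' -> B = B'.
Proof. by move=> Br Br' e; rewrite -(blk_hi Br) e blk_hi. Qed.

Lemma crossing_graph_sym B B' :
  crossing_graph rho B B' = crossing_graph rho B' B.
Proof.
by rewrite /crossing_graph crossing_sym [B == _]eq_sym andbCA.
Qed.

(* [f] records the order in which the blocks are pushed on a stack: when [C]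
   arrives, it is inserted above the entry [x] of an earlier block, which must
   not yet have been popped by an intermediate block. *)
Definition good_order (f : {set 'I_m.+1} -> nat) : Prop :=
  forall C, C \in rho -> ord_max \notin C ->
    exists x : 'I_m.+1, [/\ lo C < x < hi C, f (blk x) < f C
      & forall D, D \in rho -> f (blk x) < f D -> f D < f C -> hi D < x].

(** Among the blocks from time [t] on that meet the interval from [lo C] to [hi C], take the
    earliest, [D]. It does not cross [C] unless it is [C], so it lies inside this interval, and so
    does the entry that it straddles. That entry belongs to a block older than [D], hence older than
    [t] by the choice of [D]. *)
Lemma good_order_threshold f C t : {in rho &, injective f} -> good_order f ->
    C \in rho -> ord_max \notin C -> t <= f C ->
    (forall D, D \in rho -> t <= f D -> f D < f C -> ~~ crossing C D) ->
  exists x : 'I_m.+1, [/\ lo C < x < hi C, f (blk x) < t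
    & forall D, D \in rho -> f (blk x) < f D -> f D < t -> hi D < x].
Proof.
move=> fI fg Cr C0 tC ncross.
pose P (D : {set 'I_m.+1}) := [&& D \in rho, t <= f D &
   [exists w in D, lo C <= w <= hi C]].
have PC : P C.
  rewrite /P Cr tC; apply/exists_inP; exists (lo C); first exact: lo_in.
  by rewrite leqnn lo_le // hi_in.
have [D /and3P[Dr tD /exists_inP[w wD wC]] Dmin] := argmin_exists f PC.
have DC := Dmin _ PC.
have hull z : z \in D -> lo C <= z <= hi C.
  move=> zD; have [eDC|nDC] := eqVneq D C.
    by rewrite lo_le ?hi_ge -?eDC.
  apply: contraT => nz; have wn y : y \in C -> val w != y.
    move=> yC; apply: contraNneq nDC => /val_inj ewy.
    by rewrite -(blk_eq Dr wD) ewy (blk_eq Cr yC).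
  have lw := wn _ (lo_in Cr); have hw := wn _ (hi_in Cr).
  have fDC : f D < f C.
    by rewrite ltn_neqAle DC andbT; apply: contraNneq nDC => /fI ->.
  have := ncross _ Dr tD fDC.
  rewrite (@crossing_hull _ _ _ (lo C) (hi C) w z) ?lo_in ?hi_in //.
  by move: lw hw wC => /=; lia.
have D0 : ord_max \notin D.
  apply: contra C0 => /hull/= h; suff <- : hi C = ord_max by apply: hi_in.
  by apply: val_inj => /=; have := ltn_ord (hi C); lia.
have [x [xD fx xmax]] := fg _ Dr D0.
have xC : lo C < x < hi C.
  by have := hull _ (lo_in Dr); have := hull _ (hi_in Dr); lia.
exists x; split=> // [|E Er xE Et]; last by apply: xmax => //; lia.
rewrite ltnNge; apply/negP => tx; suff /Dmin : P (blk x) by lia.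
by rewrite /P blk_in tx; apply/exists_inP; exists x; [exact: mem_blk | lia].
Qed.

(** Otherwise the threshold 0 would be allowed, and no block is older than that. *)
Lemma good_order_crosses_earlier f C : {in rho &, injective f} ->
    good_order f -> C \in rho -> ord_max \notin C ->
  exists D, crossing_graph rho D C /\ f D < f C.
Proof.
move=> fI fg Cr C0.
case: (boolP [exists D in rho, (f D < f C) && crossing C D]).
  case/exists_inP=> D Dr /andP[DC cr]; exists D; split=> //.
  rewrite crossing_graph_sym /crossing_graph Cr Dr cr andbT.
  by apply: contraTneq DC => ->; rewrite ltnn.
move/exists_inPn=> nc; have [||x [_]] := @good_order_threshold f C 0 fI fg Cr C0.
- by [].
- by move=> D Dr _ DC; have := nc _ Dr; rewrite DC.
- by rewrite ltn0.
Qed.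

(* A good linear extension is the lexicographically least one, when blocks are
   compared by their maxima. *)
Lemma good_order_lex f B C : {in rho &, injective f} -> good_order f ->
    B \in rho -> C \in rho -> f B < f C ->
    (forall D, D \in rho -> f B <= f D -> f D < f C -> ~~ crossing C D) ->
  hi B < hi C.
Proof.
move=> fI fg Br Cr BC nc; rewrite ltnNge; apply/negP => CB.
have nCB : B != C by apply: contraTneq BC => ->; rewrite ltnn.
have {}CB : hi C < hi B.
  rewrite ltn_neqAle CB andbT; apply: contraNneq nCB => e.
  by apply/eqP/hi_inj => //; apply: val_inj.
have C0 : ord_max \notin C.
  by apply/negP => /hi_ge /=; have := ltn_ord (hi B); lia.
(* With the threshold just after [B], the entry [x] belongs to [B] or to an older block. In the
   latter case [B] must end below [x], hence below [hi C]; in the former, [B] has [x] inside the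
   interval of [C] and [hi B] outside, so it crosses [C]. *)
have [||x [xC]] := @good_order_threshold f C (f B).+1 fI fg Cr C0.
- by [].
- by move=> D Dr BD; apply: nc => //; lia.
rewrite ltnS leq_eqVlt => /predU1P[/fI|xB xmax]; last first.
  by have := xmax _ Br xB (ltnSn _); lia.
move=> /(_ (blk_in _) Br) exB _; have := nc _ Br (leqnn _) BC.
apply/negP; rewrite negbK.
apply: (@crossing_hull _ _ _ (lo C) (hi C) x (hi B));
  rewrite ?lo_in ?hi_in ?xC //; last by lia.
by rewrite -exB mem_blk.
Qed.

(** If the orders differ, take the [f]-least block [X] that [g] moves behind some later one, and
    symmetrically the [g]-least [Y]. Then [f] has [X] before [Y] and [g] has [Y] before [X], and
    [good_order_lex] applies to both, ordering their maxima in opposite ways. *)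
Lemma good_order_unique f g : {in rho &, injective f} ->
    {in rho &, injective g} -> good_order f -> good_order g ->
    (forall B C, crossing_graph rho B C -> (f B < f C) = (g B < g C)) ->
  {in rho &, forall B C, (f B < f C) = (g B < g C)}.
Proof.
move=> fI gI fg gg cfg.
pose inv (u v : {set 'I_m.+1} -> nat) B :=
  (B \in rho) && [exists C in rho, (u B < u C) && (v C < v B)].
suff noinv : forall B, ~~ inv f g B.
  move=> B C Br Cr; have [->|nBC] := eqVneq B C; first by rewrite !ltnn.
  have nf : f B != f C by apply: contraNneq nBC => /fI ->.
  have ng : g B != g C by apply: contraNneq nBC => /gI ->.
  have := noinv B; rewrite /inv Br /= => /exists_inPn/(_ _ Cr).
  have := noinv C; rewrite /inv Cr /= => /exists_inPn/(_ _ Br).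
  lia.
move=> B; apply/negP => Binv.
have [X Xinv Xmin] := argmin_exists f Binv.
have [Xr /exists_inP[Z Zr /andP[XZ ZX]]] := andP Xinv.
have Zinv : inv g f Z.
  by rewrite /inv Zr; apply/exists_inP; exists X; rewrite ?ZX.
have [Y Yinv Ymin] := argmin_exists g Zinv.
have [Yr /exists_inP[W Wr /andP[YW WY]]] := andP Yinv.
have YX : g Y < g X by have := Ymin _ Zinv; lia.
have XY : f X < f Y.
  have /Xmin : inv f g W; last by lia.
  by rewrite /inv Wr; apply/exists_inP; exists Y; rewrite ?WY.
(* A block [D] from [P] up to [Q] in [u] that crosses [Q] also precedes [Q] in [v]; being inverted
   with respect to [P], it contradicts the minimality of [Q]. *)
have step u v P Q : {in rho &, injective u} -> {in rho &, injective v} ->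
    good_order u ->
    (forall B C, crossing_graph rho B C -> (u B < u C) = (v B < v C)) ->
    P \in rho -> Q \in rho -> u P < u Q -> v Q < v P ->
    (forall D, inv v u D -> v Q <= v D) -> hi P < hi Q.
  move=> uI vI ug cuv Pr Qr PQ QP Qmin; apply: (good_order_lex uI) => //.
  move=> D Dr PD DQ; apply/negP => cQD.
  have cg : crossing_graph rho D Q.
    rewrite crossing_graph_sym /crossing_graph Qr Dr cQD andbT.
    by apply: contraTneq DQ => ->; rewrite ltnn.
  have := cuv _ _ cg; rewrite DQ => /esym DQv.
  have [e|nDP] := eqVneq D P; first by rewrite e ltnNge (ltnW QP) in DQv.
  have {}PD : u P < u D.
    by rewrite ltn_neqAle PD andbT; apply: contra_neq nDP => /esym/uI ->.
  have /Qmin : inv v u D; last by rewrite leqNgt DQv.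
  by rewrite /inv Dr; apply/exists_inP; exists P; rewrite // PD (ltn_trans DQv QP).
have h1 : hi X < hi Y by apply: (step f g).
have h2 : hi Y < hi X.
  by apply: (step g f) => // C D cg; rewrite cfg.
by rewrite ltnNge (ltnW h1) in h2.
Qed.

End Blocks.

(** * Hook configurations *)

(** Compared with [VHC], disjointness in the plane becomes nesting of positions, free of real
    numbers. *)
Definition laminar_hooks m (pi : 'S_m) (H : seq (hook m)) : Prop :=
  [/\ map fst H = descents pi,
      (forall h, h \in H -> is_hook pi h),
      (forall h, h \in H -> no_point_above pi h) &
      (forall h h', h \in H -> h' \in H ->
         h.1 < h'.1 -> h'.1 < h.2 -> h'.2 < h.2)].

Lemma uniq_map_inj (T U : eqType) (g : T -> U) s :
  uniq (map g s) -> {in s &, injective g}.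
Proof.
elim: s => //= a s IH /andP[nas us] x y; rewrite !inE.
move=> /predU1P[->|xs] /predU1P[->|ys] // e; last exact: IH.
  by rewrite e map_f in nas.
by rewrite -e map_f in nas.
Qed.

Lemma descents_uniq m (pi : 'S_m) : uniq (descents pi).
Proof. by rewrite filter_uniq // enum_uniq. Qed.

(** * Disjointness in the plane as nesting *)

Section RealHooks.
Import Order.TTheory GRing.Theory Num.Theory.
Variables (R : realType) (m : nat) (pi : 'S_m).
Implicit Type h : hook m.

Lemma hook_pointsP h (p : R * R) :
  hook_points pi h p <->
  (p.1 = (val h.1)%:R /\ ((val (pi h.1))%:R <= p.2 <= (val (pi h.2))%:R)%R)%R \/
  (((val h.1)%:R <= p.1 <= (val h.2)%:R)%R /\ p.2 = (val (pi h.2))%:R)%R.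
Proof. by rewrite /hook_points /= /plot_point /= /setU /setX /= !in_itv /=. Qed.

Lemma hook_points_bounds h (p : R * R) : is_hook pi h -> hook_points pi h p ->
  [/\ ((val h.1)%:R <= p.1 <= (val h.2)%:R)%R,
      (p.2 <= (val (pi h.2))%:R)%R &
      ((val h.1)%:R < p.1)%R -> p.2 = (val (pi h.2))%:R%R].
Proof.
case/andP=> h12 _ /hook_pointsP[[e /andP[_ le2]]|[le1 e]].
  split=> //; first by rewrite e lexx ler_nat ltnW.
  by rewrite e ltxx.
by split=> //; rewrite e.
Qed.

Lemma meet_only_sym h h' :
  meet_only_at_endpoints R pi h h' -> meet_only_at_endpoints R pi h' h.
Proof. by move=> mo p hp h'p; case: (mo p) => // [[]|[]]; [right|left]. Qed.

Lemma VHC_laminar (H : seq (hook m)) : VHC R pi H <-> laminar_hooks pi H.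
Proof.
split=> -[Hd Hh Hn Hm]; split=> //; last first.
  suff mo h h' : h \in H -> h' \in H -> h.1 < h'.1 ->
      meet_only_at_endpoints R pi h h'.
    move=> h h' hH h'H; have [lt|gt|e] := ltngtP h.1 h'.1; first
      by move=> _; exact: mo.
      by move=> _; apply/meet_only_sym/mo.
    suff -> : h = h' by rewrite eqxx.
    by apply: (uniq_map_inj _ hH h'H (val_inj e)); rewrite Hd descents_uniq.
  (* A common point lies to the right of [h.1], so on the horizontal part of [h]. If [h'] started
     under that part, nesting would keep it strictly below; so [h'] starts where [h] ends, and the
     point is this endpoint. *)
  move=> hH h'H hh' p hp h'p.
  have [hp1 hp2 hp3] := hook_points_bounds (Hh _ hH) hp.
  have [h'p1 h'p2 h'p3] := hook_points_bounds (Hh _ h'H) h'p.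
  have lt1 : ((val h.1)%:R < p.1)%R.
    by case/andP: h'p1 => le1 _; apply: lt_le_trans le1; rewrite ltr_nat.
  have e2 := hp3 lt1.
  have [h'h|hh2] := ltnP h'.1 h.2.
    have h'2 := Hm _ _ hH h'H hh' h'h.
    have /(Hn _ hH) : h.1 < h'.2 < h.2.
      by have /andP[lt12 _] := Hh _ h'H; rewrite h'2 (ltn_trans hh').
    by move: h'p2; rewrite e2 ler_nat leqNgt => /negbTE ->.
  have e21 : h.2 = h'.1.
    apply/val_inj/eqP; rewrite eqn_leq hh2 -(ler_nat R).
    by case/andP: hp1 => _; case/andP: h'p1 => + _; apply: le_trans.
  have e1 : p.1 = (val h.2)%:R%R.
    apply/le_anti; case/andP: hp1 => _ ->.
    by rewrite e21; case/andP: h'p1.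
  left; rewrite -e21; suff : p = plot_point R pi h.2 by [].
  by rewrite [p]surjective_pairing e1 e2.
move=> h h' hH h'H hh' h'h.
have nhh' : h != h' by apply: contraTneq hh' => ->; rewrite ltnn.
have mo := Hm _ _ hH h'H nhh'.
have /andP[h12 ph12] := Hh _ hH; have /andP[h'12 ph'12] := Hh _ h'H.
have plt : pi h'.1 < pi h.2 by apply: (Hn _ hH); rewrite hh'.
have n2 : h'.2 != h.2.
  apply/eqP => e2; have [||[_]|[+ _]] := mo (plot_point R pi h.2).
  - by apply/hook_pointsP; right; rewrite /= lexx ler_nat ltnW.
  - by apply/hook_pointsP; right; rewrite /= -e2 lexx ler_nat ltnW.
  - by case=> /eqP; rewrite eqr_nat => /eqP e; rewrite e ltnn in h'h.
  - by case=> /eqP; rewrite eqr_nat => /eqP e; rewrite e ltnn in h12.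
rewrite ltn_neqAle n2 leqNgt; apply/negP => lt2.
(* If [h'] ended beyond [h], its vertical part would cut the horizontal part of [h], at abscissa
   [h'.1] and height [pi h.2]. *)
have p2 : pi h.2 < pi h'.2 by apply: (Hn _ h'H); rewrite h'h.
have [||[+ _]|[+ _]] := mo ((val h'.1)%:R, (val (pi h.2))%:R)%R.
- by apply/hook_pointsP; right; rewrite /= !ler_nat (ltnW hh') (ltnW h'h).
- by apply/hook_pointsP; left; rewrite /= !ler_nat (ltnW plt) (ltnW p2).
- by case=> /eqP; rewrite eqr_nat => /eqP e; rewrite e ltnn in h'h.
- by case=> /eqP; rewrite eqr_nat => /eqP e; rewrite e ltnn in hh'.
Qed.

End RealHooks.

(** * Colors as innermost covering hooks *)

(** Closed on the right, unlike [sees], so that the rule for northeast endpoints is no longer a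
    separate case. *)
Definition covers m (h : hook m) (l : 'I_m) : bool := h.1 < l <= h.2.

(* The position of the first entry of color [c], hence [min_hat] of its block. *)
Definition color_start m (c : option (hook m)) : nat :=
  if c is Some h then (val h.1).+1 else 0.

Section Coloring.
Variables (m : nat) (pi : 'S_m) (H : seq (hook m)).
Hypothesis lamH : laminar_hooks pi H.
Local Notation col := (point_color pi H).
Implicit Types (h : hook m) (l p : 'I_m).

Lemma hook_inj1 h h' : h \in H -> h' \in H -> h.1 = h'.1 -> h = h'.
Proof.
case: lamH => e _ _ _; apply: (@uniq_map_inj _ _ fst).
by rewrite e descents_uniq.
Qed.

Lemma hook_lt h : h \in H -> h.1 < h.2.
Proof. by case: lamH => _ Hh _ _ /Hh/andP[]. Qed.

Lemma hook_pi_lt h : h \in H -> pi h.1 < pi h.2.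
Proof. by case: lamH => _ Hh _ _ /Hh/andP[]. Qed.

Lemma hook_above h l : h \in H -> h.1 < l -> l < h.2 -> pi l < pi h.2.
Proof. by case: lamH => _ _ Hn _ /Hn Hh h1 h2; apply: Hh; rewrite h1. Qed.

Lemma hook_nested h h' : h \in H -> h' \in H ->
  h.1 < h'.1 -> h'.1 < h.2 -> h'.2 < h.2.
Proof. by case: lamH => _ _ _; apply. Qed.

Lemma covers_inner h h' l : h \in H -> h' \in H -> h.1 < h'.1 ->
  covers h l -> covers h' l -> h'.2 < h.2.
Proof.
move=> hH h'H hh' /andP[_ l2] /andP[l3 _].
by apply: hook_nested => //; apply: leq_trans l3 l2.
Qed.

Lemma descent_hook (p q : 'I_m) : val q = p.+1 -> pi q < pi p ->
  exists2 h, h \in H & h.1 = p.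
Proof.
case: lamH => e _ _ _ qp pqp; have : p \in descents pi.
  rewrite mem_filter mem_enum andbT; apply/existsP; exists q.
  by rewrite qp eqxx.
by rewrite -e => /mapP[h hH ->]; exists h.
Qed.

Lemma hook_descent h : h \in H ->
  exists2 q : 'I_m, val q = (val h.1).+1 & pi q < pi h.1.
Proof.
case: lamH => e _ _ _ hH; have : h.1 \in descents pi by rewrite -e map_f.
by rewrite mem_filter => /andP[/existsP[q /andP[/eqP ? ?]] _]; exists q.
Qed.

(** Among nested hooks the one that starts last is the lowest, hence the first seen. At a northeast
    endpoint, a hook starting later than the one that ends there would already have ended. *)
Lemma point_color_innermost h l : h \in H -> covers h l ->
  (forall h', h' \in H -> covers h' l -> h'.1 <= h.1) -> col l = Some h.
Proof.
move=> hH hl hmax; rewrite /point_color; case: pickP => [h0|no].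
  move=> /andP[h0H /eqP e]; congr Some; apply: hook_inj1 => //; apply: val_inj.
  have h0l : covers h0 l by rewrite /covers -e leqnn hook_lt.
  have := hmax _ h0H h0l; rewrite leq_eqVlt => /predU1P[//|lt].
  have := covers_inner h0H hH lt h0l hl; rewrite e.
  by case/andP: hl => _; rewrite leqNgt => /negbTE ->.
have hs h' : h' \in H -> sees l h' = covers h' l.
  move=> h'H; rewrite /covers /sees; congr (_ && _).
  rewrite ltn_neqAle; case: eqVneq => // /val_inj e.
  by have := no h'; rewrite h'H /= -e eqxx.
have low h' : h' \in H -> covers h' l -> h' != h -> pi h.2 < pi h'.2.
  move=> h'H h'l nh.
  have lt : h'.1 < h.1.
    rewrite ltn_neqAle hmax // andbT; apply: contra_neq nh => /val_inj.
    exact: hook_inj1.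
  apply: hook_above => //; last exact: covers_inner lt h'l hl.
  exact: ltn_trans lt (hook_lt hH).
rewrite /first_seen; case: pickP => [h0 /and3P[h0H]|/(_ h)].
  rewrite hs // => h0l /forallP/(_ h); rewrite hH hs // hl /= => le.
  congr Some; apply: contraTeq le => nh; rewrite -ltnNge; exact: low.
rewrite hH hs // hl /= => /negbT/negP[]; apply/forallP => h'.
apply/implyP => /andP[h'H]; rewrite hs // => h'l.
by have [->//|nh] := eqVneq h' h; apply/ltnW/low.
Qed.

Lemma point_color_cases l :
  (col l = None /\ (forall h, h \in H -> ~~ covers h l)) \/
  (exists h, [/\ col l = Some h, h \in H, covers h l &
    forall h', h' \in H -> covers h' l -> h'.1 <= h.1]).
Proof.
case: (boolP [exists h, (h \in H) && covers h l]).
  case/existsP=> h hP; right.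
  case: (@argmax_exists _ (fun h => (h \in H) && covers h l)
           (fun h => val h.1) h hP).
  move=> h0 /andP[h0H h0l] h0max; exists h0.
  have h0max' h' : h' \in H -> covers h' l -> h'.1 <= h0.1.
    by move=> h'H h'l; apply: h0max; rewrite h'H.
  by split=> //; apply: point_color_innermost.
rewrite negb_exists => /forallP no; left; split=> [|h hH]; last first.
  by have := no h; rewrite hH.
rewrite /point_color; case: pickP => [h /andP[hH /eqP e]|_].
  by have := no h; rewrite hH /covers -e leqnn hook_lt.
rewrite /first_seen; case: pickP => [h /and3P[hH /andP[h1 h2] _]|//].
by have := no h; rewrite hH /covers h1 ltnW.
Qed.

Lemma color_start_le l : color_start (col l) <= l.
Proof. by case: (point_color_cases l) => [[->]|[h [-> _ /andP[]]]]. Qed.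

Lemma color_start_inner l h : h \in H -> color_start (col l) <= h.1 ->
  ~~ covers h l.
Proof.
move=> hH; case: (point_color_cases l) => [[-> no]|[h0 [-> h0H h0l h0max]]] /=.
  by move=> _; apply: no.
by move=> lt; apply/negP => /(h0max _ hH); rewrite leqNgt lt.
Qed.

Lemma color_ended l h : h \in H -> color_start (col l) <= h.1 -> h.1 < l ->
  h.2 < l.
Proof.
move=> hH ls hl; have := color_start_inner hH ls.
by rewrite /covers hl /= -ltnNge.
Qed.

Lemma argmax_descent (p l : 'I_m) : p < l ->
    (forall r : 'I_m, p <= r -> r <= l -> pi r <= pi p) ->
  exists2 h, h \in H & h.1 = p.
Proof.
move=> pl pmax; have qm : p.+1 < m by apply: leq_ltn_trans (ltn_ord l).
apply: (@descent_hook p (Ordinal qm)) => //.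
have := pmax (Ordinal qm) (leqnSn _) pl; rewrite leq_eqVlt => /predU1P[|//].
by move=> /val_inj/perm_inj/(congr1 val)/=; lia.
Qed.

(** Otherwise the greatest entry of the range would be a descent top before [l]; by [color_ended]
    its hook ends before [l], at a still greater value. *)
Lemma color_lower_before l p : color_start (col l) <= p -> p < l -> pi p < pi l.
Proof.
move=> sp pl.
have [|q /andP[sq ql] qmax] := @argmax_exists _
  (fun q : 'I_m => (color_start (col l) <= q) && (q <= l)) (fun q => val (pi q)) p.
  by rewrite sp ltnW.
have [e|nql] := eqVneq q l.
  have := qmax p; rewrite sp (ltnW pl) e leq_eqVlt => /(_ isT)/predU1P[|//].
  by move=> /val_inj/perm_inj epl; rewrite epl ltnn in pl.
have {}ql : q < l by rewrite ltn_neqAle ql andbT.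
have [r qr rl|h hH hq] := @argmax_descent q l ql.
  by apply: qmax; rewrite rl (leq_trans sq).
have := @color_ended l h hH; rewrite hq => /(_ sq ql) h2l.
have := qmax h.2; rewrite (ltnW h2l) (leq_trans sq) ?andbT; last first.
  by rewrite -hq ltnW // hook_lt.
by move=> /(_ isT); rewrite leqNgt -hq hook_pi_lt.
Qed.

Lemma color_ended_lt l h : h \in H -> color_start (col l) <= h.1 -> h.1 < l ->
  pi h.2 < pi l.
Proof.
move=> hH ls hl; apply: color_lower_before; last exact: color_ended.
by apply: leq_trans ls _; rewrite ltnW // hook_lt.
Qed.

Lemma point_color_some l h : col l = Some h ->
  [/\ h \in H, covers h l & pi l <= pi h.2].
Proof.
move=> e; case: (point_color_cases l) => [[]|[h' []]]; rewrite e //.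
move=> [<-] hH hl _; split=> //; case/andP: hl => h1.
rewrite leq_eqVlt => /predU1P[/val_inj->//|h2].
by rewrite ltnW // hook_above.
Qed.

Lemma point_color_succ h q : h \in H -> val q = (val h.1).+1 -> col q = Some h.
Proof.
move=> hH qh; apply: point_color_innermost => //.
  by rewrite /covers qh ltnSn hook_lt.
by move=> h' _ /andP[]; rewrite qh ltnS.
Qed.

Lemma point_color_ne h : h \in H -> col h.2 = Some h.
Proof.
move=> hH; have hl : covers h h.2 by rewrite /covers leqnn hook_lt.
apply: point_color_innermost => // h' h'H h'l.
rewrite leqNgt; apply/negP => lt.
have := covers_inner hH h'H lt hl h'l; case/andP: h'l => _.
by rewrite leqNgt => /negbTE ->.
Qed.

(** This is the stack rule behind [reading_order]. If [l'] comes first, all these hooks start before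
    [l] and have ended below it; if [l] comes first, one of them ends above it. *)
Lemma color_order l l' : color_start (col l) < color_start (col l') ->
  (l' < l) = all (fun h => (color_start (col l) <= h.1) &&
                           ((val h.1).+1 <= color_start (col l'))
                           ==> (pi h.2 < pi l)) H.
Proof.
move=> ll'; apply/idP/allP => [l'l h hH|Hall].
  apply/implyP => /andP[sh hs]; apply: color_ended_lt => //.
  exact: leq_trans hs (leq_trans (color_start_le _) (ltnW l'l)).
rewrite ltnNge; apply/negP; rewrite leq_eqVlt => /predU1P[/val_inj e|lt].
  by rewrite e ltnn in ll'.
case: (point_color_cases l') => [[e]|[h' [e h'H h'l' h'max]]].
  by rewrite e in ll'.
have [ls|sl] := ltnP l (color_start (col l')); last first.
  (* Here [l] is read after the color of [l'] has started, and the hook of [l'] itself ends above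
     [l]. *)
  have lt1 := color_lower_before sl lt.
  have [_ _ le1] := point_color_some e.
  have := Hall _ h'H; rewrite e /= ltnSn andbT.
  rewrite e /= ltnS in ll'; rewrite ll' /= ltnNge => /negP[].
  by apply: ltnW; apply: leq_trans lt1 le1.
rewrite e /= ltnS in ls.
(* Here the color of [l'] starts after [l]: the greatest entry from [l] to [h'.1] is a descent top,
   and its hook ends above [pi l]. *)
have [|q /andP[lq qh] qmax] := @argmax_exists _
  (fun q : 'I_m => (l <= q) && (q <= h'.1)) (fun q => val (pi q)) l.
  by rewrite leqnn ls.
have [h hH hq] : exists2 h, h \in H & h.1 = q.
  have [->|nq] := eqVneq q h'.1; first by exists h'.
  have qh' : q < h'.1 by rewrite ltn_neqAle nq qh.
  apply: (argmax_descent qh') => r qr rh.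
  by apply: qmax; rewrite rh (leq_trans lq).
have := Hall _ hH; rewrite hq e /= ltnS qh andbT.
rewrite (leq_trans (color_start_le _) lq) /= ltnNge => /negP[].
apply/ltnW/leq_ltn_trans; last exact: (hook_pi_lt hH).
by rewrite hq; apply: qmax; rewrite leqnn.
Qed.

End Coloring.

(** * The permutation is determined by the order of the blocks *)

(* An entry [u] is read after the first entries of a later block [C] exactly
   when no block up to [C] pops it, and then it comes after all of [C]. *)
Definition reading_order m (rho : {set {set 'I_m.+1}})
    (f : {set 'I_m.+1} -> nat) (pi : 'S_m) : Prop :=
  forall i j : 'I_m,
  let u := lift ord_max (pi i) in let v := lift ord_max (pi j) in
  let B := finset.pblock rho u in let C := finset.pblock rho v in
  (B = C -> (i < j) = (u < v)) /\
  (f B < f C -> (j < i) =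
     [forall D in rho, (f B < f D) && (f D <= f C) ==> (hi D < u)]).

Lemma perm_order_inj m (p q : 'S_m) :
  (forall a b, (p a < p b) = (q a < q b)) -> p = q.
Proof.
have rank (s : 'S_m) a : val (s a) = #|[set b | s b < s a]%SET|.
  have -> : [set b | s b < s a]%SET = s @^-1: [set c : 'I_m | c < s a]%SET.
    by apply/setP => b; rewrite !inE.
  rewrite card_preimset; last exact: perm_inj.
  rewrite -sum1dep_card -(big_ord_widen _ (fun=> 1)) ?sum1_card ?card_ord //.
  exact: ltnW.
move=> pq; apply/permP => a; apply: val_inj; rewrite [LHS]rank [RHS]rank.
by apply: eq_card => b; rewrite !inE pq.
Qed.

(** Passing to inverses compares the positions of two given values, which [reading_order] settles
    from [rho] and the order of the blocks. *)
Lemma reading_order_unique m (rho : {set {set 'I_m.+1}}) f g (pi sigma : 'S_m) :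
    finset.partition rho [set: 'I_m.+1]%SET -> {in rho &, injective f} ->
    {in rho &, forall B C, (f B < f C) = (g B < g C)} ->
    reading_order rho f pi -> reading_order rho g sigma ->
  pi = sigma.
Proof.
move=> rhoP fI fg rf rg; apply: invg_inj; apply: perm_order_inj => a b.
pose B := finset.pblock rho (lift ord_max a).
pose C := finset.pblock rho (lift ord_max b).
have Br : B \in rho by apply: blk_in. have Cr : C \in rho by apply: blk_in.
have [eab|nab] := eqVneq a b; first by rewrite eab !ltnn.
have np (s : 'S_m) : s^-1%g a != s^-1%g b :> nat.
  by apply: contra_neq nab => /val_inj/perm_inj.
have [e1 e2] := rf (pi^-1%g a) (pi^-1%g b).
have [e3 e4] := rf (pi^-1%g b) (pi^-1%g a).
have [e5 e6] := rg (sigma^-1%g a) (sigma^-1%g b).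
have [e7 e8] := rg (sigma^-1%g b) (sigma^-1%g a).
rewrite !permKV -/B -/C in e1 e2 e3 e4 e5 e6 e7 e8.
have same X Y u : X \in rho -> Y \in rho ->
  [forall D in rho, (f X < f D) && (f D <= f Y) ==> (hi D < u)] =
  [forall D in rho, (g X < g D) && (g D <= g Y) ==> (hi D < u)].
  move=> Xr Yr; apply: eq_forallb_in => D Dr; 
  by rewrite fg // [f D <= _]leqNgt [g D <= _]leqNgt fg.
have [lt|gt|e] := ltngtP (f B) (f C).
- have lt' : g B < g C by rewrite -fg.
  have := np pi; have := np sigma; have := e2 lt; have := e6 lt'.
  rewrite -same // => <- e ns np'.
  by rewrite ltn_neqAle np' leqNgt e -leqNgt [RHS]ltn_neqAle ns.
- have gt' : g C < g B by rewrite -fg.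
  by rewrite e4 // e8 // same.
- by rewrite e1 ?e5 //; apply: fI.
Qed.

(** * The block structure of a configuration *)

Lemma bigmin_seq_le (I : eqType) (r : seq I) (P : pred I) F m i :
  i \in r -> P i -> \big[minn/m]_(j <- r | P j) F j <= F i.
Proof.
elim: r => // a r IH; rewrite inE big_cons => /predU1P[<-|ir] Pi.
  by rewrite Pi geq_minl.
by have := IH ir Pi; case: ifP => // _ le; apply: leq_trans le; apply: geq_minr.
Qed.

Section ColorPartition.
Variables (m : nat) (pi : 'S_m) (H : seq (hook m)).
Local Notation rho := (color_partition pi H).
Local Notation blk := (finset.pblock rho).
Local Notation vcol := (value_color pi H).
Local Notation pt i := (lift ord_max (pi i)).

Lemma color_partitionP : finset.partition rho [set: 'I_m.+1]%SET.
Proof. exact: preim_partitionP. Qed.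

Lemma mem_color_block u v : (v \in blk u) = (vcol u == vcol v).
Proof.
apply: (@pblock_equivalence_partition _ (fun x y => vcol x == vcol y) [set: _]%SET);
  rewrite ?inE //.
by move=> x y z _ _ _; split=> // /eqP->.
Qed.

Lemma color_block_eq u v : (blk u == blk v) = (vcol u == vcol v).
Proof.
apply/eqP/eqP => [e|e]; last by apply/setP => w; rewrite !mem_color_block e.
apply/eqP; rewrite -mem_color_block e mem_blk //; exact: color_partitionP.
Qed.

Lemma value_color_max : vcol ord_max = None.
Proof. by rewrite /value_color unlift_none. Qed.

Lemma value_color_pt i : vcol (pt i) = point_color pi H i.
Proof. by rewrite /value_color liftK permK. Qed.

Lemma valueP (v : 'I_m.+1) : v = ord_max \/ exists i, v = pt i.
Proof.
case: (unliftP ord_max v) => [u ->|->]; [right | by left].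
by exists (pi^-1%g u); rewrite permKV.
Qed.

Lemma val_pt i : pt i = pi i :> nat.
Proof. by rewrite [LHS]lift_max. Qed.

Lemma mem_hat v i : (i \in hat pi (blk v)) = (vcol v == point_color pi H i).
Proof. by rewrite inE mem_color_block value_color_pt. Qed.

Lemma color_blockP B : B \in rho -> exists v, B = blk v.
Proof.
move=> Br; have [x xB] := block_inhabited color_partitionP Br.
by exists x; rewrite (blk_eq color_partitionP Br xB).
Qed.

Hypothesis lamH : laminar_hooks pi H.

Lemma value_color_some v h : vcol v = Some h -> h \in H.
Proof.
have [->|[i ->]] := valueP v; first by rewrite value_color_max.
by rewrite value_color_pt => /(point_color_some lamH)[].
Qed.

Lemma min_hat_block v : min_hat pi (blk v) = color_start (vcol v).
Proof.
have lower i : i \in hat pi (blk v) -> color_start (vcol v) <= i.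
  by rewrite mem_hat => /eqP->; apply: color_start_le.
have cm : color_start (vcol v) <= m.
  by case: (vcol v) => //= h; apply: ltn_ord.
apply/eqP; rewrite eqn_leq; apply/andP; split; last first.
  by apply: (big_ind (leq (color_start (vcol v)))) => // x y; rewrite leq_min => ->.
have reached i : point_color pi H i = vcol v -> val i = color_start (vcol v) ->
    min_hat pi (blk v) <= color_start (vcol v).
  move=> e <-; apply: bigmin_seq_le; first by rewrite mem_index_enum.
  by rewrite mem_hat e.
case e: (vcol v) => [h|] /=.
  have hH := value_color_some e; have [q qh _] := hook_descent lamH hH.
  have := reached q; rewrite e; apply=> //; exact: (point_color_succ lamH).
(* For [m = 0] the minimum is over the empty set, and its default [m] is the expected 0. *)
have [m0|m0] := posnP m.
  apply: (@leq_trans m); last by rewrite m0.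
  apply: (big_ind (fun x => x <= m)) => [//|x y le _|i _];
    last by rewrite ltnW ?ltn_ord.
  by apply: leq_trans le; apply: geq_minl.
(* The first entry is blue: the color of any hook starts at a positive position. *)
have := reached (Ordinal m0); rewrite e; apply=> //.
have := color_start_le lamH (Ordinal m0).
by case: (point_color pi H _).
Qed.

Lemma min_hat_inj : {in rho &, injective (min_hat pi)}.
Proof.
move=> B C /color_blockP[u ->] /color_blockP[v ->]; rewrite !min_hat_block => e.
apply/eqP; rewrite color_block_eq.
case eu: (vcol u) e => [h|]; case ev: (vcol v) => [h'|] //= [e].
apply/eqP; congr Some; apply: (hook_inj1 lamH); last exact: val_inj.
  exact: value_color_some eu.
exact: value_color_some ev.
Qed.

Lemma hi_block_some v h : vcol v = Some h -> hi (blk v) = pt h.2.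
Proof.
move=> e; have hH := value_color_some e.
have ph : pt h.2 \in blk v.
  by rewrite mem_color_block value_color_pt e (point_color_ne lamH).
have [hb hmax] := hiP ph; apply/val_inj/eqP; rewrite eqn_leq hmax // andbT.
move: hb; rewrite mem_color_block e.
have [->|[i ->]] := valueP (hi (blk v)); first by rewrite value_color_max.
rewrite value_color_pt => /eqP/esym/(point_color_some lamH)[_ _]; rewrite -!val_pt.
by [].
Qed.

Lemma block_color_none v : vcol v = None -> ord_max \in blk v.
Proof. by rewrite mem_color_block value_color_max => ->. Qed.

Lemma hook_block h : h \in H -> exists2 q : 'I_m, val q = (val h.1).+1 &
  [/\ pi q < pi h.1, vcol (pt q) = Some h & min_hat pi (blk (pt q)) = q].
Proof.
move=> hH; have [q qh pq] := hook_descent lamH hH; exists q => //.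
have e : vcol (pt q) = Some h 
  by rewrite value_color_pt; apply: (point_color_succ lamH).
by split=> //; rewrite min_hat_block e.
Qed.

Lemma min_hat_good : good_order rho (min_hat pi).
Proof.
move=> C /color_blockP[v ->] C0.
case e: (vcol v) => [h|]; last by rewrite block_color_none in C0.
have hH := value_color_some e; have [q qh [pq eq _]] := hook_block hH.
have qv : pt q \in blk v by rewrite mem_color_block e eq.
(* The straddled entry is the southwest endpoint: the descent puts it above an entry of [C], and the
   hook puts the maximum of [C] above it. *)
exists (pt h.1); rewrite !min_hat_block (hi_block_some e) !val_pt.
rewrite value_color_pt e /=.
split.
- rewrite (hook_pi_lt lamH) // andbT; apply: leq_ltn_trans pq.
  by rewrite -val_pt; apply: lo_le.
- by rewrite ltnS (color_start_le lamH).
move=> D /color_blockP[w ->]; rewrite min_hat_block.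
case ew: (vcol w) => [h'|] //= lt1 lt2; rewrite (hi_block_some ew) !val_pt.
by apply: (color_ended_lt lamH) => //; apply: value_color_some ew.
Qed.

Lemma min_hat_reading : reading_order rho (min_hat pi) pi.
Proof.
move=> i j u v B C; rewrite {}/B {}/C {}/u {}/v; split.
  move=> /eqP; rewrite color_block_eq !value_color_pt => /eqP e.
  rewrite !val_pt; have [->|nij] := eqVneq i j; first by rewrite !ltnn.
  have lt (k l : 'I_m) : point_color pi H k = point_color pi H l -> k < l ->
      pi k < pi l.
    move=> ekl; apply: (color_lower_before lamH); rewrite -ekl.
    exact: color_start_le.
  have [ij|ji|/val_inj e2] := ltngtP i j; last by rewrite e2 eqxx in nij.
    by rewrite lt.
  by rewrite ltnNge ltnW // lt.
rewrite !min_hat_block !value_color_pt => ij.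
rewrite (color_order lamH) //; apply/allP/forall_inP => [Hall D Dr|Hall h hH].
  have [w ->] := color_blockP Dr.
  rewrite min_hat_block; case ew: (vcol w) => [h|]; last by rewrite ltn0.
  apply/implyP => le; have := Hall _ (value_color_some ew).
  by rewrite (hi_block_some ew) !val_pt; move=> /= /implyP; apply.
have [q qh [_ eq _]] := hook_block hH.
have := Hall _ (blk_in color_partitionP (pt q)).
by rewrite min_hat_block eq (hi_block_some eq) !val_pt.
Qed.

Lemma color_orientation_lt B C : crossing_graph rho B C ->
  ((B, C) \in color_orientation pi H) = (min_hat pi B < min_hat pi C).
Proof. by move=> cg; rewrite inE /= cg. Qed.

Lemma color_orientationP : is_orientation rho (color_orientation pi H).
Proof.
split=> [B C|B C cg]; first by rewrite inE /= => /andP[].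
have cg' : crossing_graph rho C B by rewrite crossing_graph_sym.
rewrite !color_orientation_lt //.
have : min_hat pi B != min_hat pi C.
  move: cg => /and4P[Br Cr nBC _]; apply: contra_neq nBC; exact: min_hat_inj.
by case: ltngtP.
Qed.

Lemma color_orientation_acyclic : acyclic (color_orientation pi H).
Proof.
case=> // B c /= cyc; suff : min_hat pi B < min_hat pi B by rewrite ltnn.
have : path (fun B C => min_hat pi B < min_hat pi C) B (rcons c B).
  by apply: sub_path cyc => C D; rewrite inE => /andP[].
move/(order_path_min (fun _ _ _ => @ltn_trans _ _ _))/allP; apply.
by rewrite mem_rcons mem_head.
Qed.

Lemma min_hat_max : min_hat pi (blk ord_max) = 0.
Proof. by rewrite min_hat_block value_color_max. Qed.

Lemma block_nonmax B : B \in rho -> B != blk ord_max -> ord_max \notin B.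
Proof.
by move=> Br; apply: contraNN => nB; rewrite (blk_eq color_partitionP Br nB).
Qed.

(** Passing repeatedly to a crossing block with smaller [min_hat] ends at the block of n. *)
Lemma color_connected : crossing_graph_connected rho.
Proof.
have toroot B : B \in rho -> connect (crossing_graph rho) B (blk ord_max).
  have [k] := ubnP (min_hat pi B); elim: k B => // k IH B Bk Br.
  have [->|nB] := eqVneq B (blk ord_max); first exact: connect0.
  have [D [cg lt]] := good_order_crosses_earlier color_partitionP min_hat_inj
    min_hat_good Br (block_nonmax Br nB).
  apply: (@connect_trans _ _ D).
    by apply: connect1; rewrite crossing_graph_sym.
  by apply: IH; [apply: leq_trans lt _ | case/and4P: cg].
move=> B C Br Cr; apply: connect_trans (toroot _ Br) _.
rewrite (sym_connect_sym (@crossing_graph_sym _ _)); exact: toroot.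
Qed.

Lemma color_sources :
  sources rho (color_orientation pi H) = [set blk ord_max]%SET.
Proof.
apply/setP => B; rewrite !inE; apply/andP/eqP => [[Br /eqP deg]|->]; last first.
  split; first exact: blk_in color_partitionP _.
  apply/eqP; apply: eq_card0 => C; rewrite !inE min_hat_max ltn0 andbF //.
apply/eqP; apply: contraT => nB.
have [D [cg lt]] := good_order_crosses_earlier color_partitionP min_hat_inj
    min_hat_good Br (block_nonmax Br nB).
have := card0_eq deg D; rewrite !inE /= cg lt //.
Qed.

Lemma Phi_Ptilde : Ptilde_c (Phi (pi, H)).
Proof.
split; [exact: color_partitionP | exact: color_connected |
  exact: color_orientationP | exact: color_orientation_acyclic |
  exact: color_sources].
Qed.

End ColorPartition.

(** * Injectivity *)

Lemma eq_from_map_fst (T U : eqType) (s t : seq (T * U)) :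
    map fst s = map fst t ->
    (forall a b, a \in s -> b \in t -> a.1 = b.1 -> a = b) -> s = t.
Proof.
elim: s t => [|a s IH] [|b t] //= [e1 e2] st; congr cons.
  by apply: st; rewrite ?mem_head.
by apply: IH => // c d cs dt; apply: st; rewrite inE ?cs ?dt orbT.
Qed.

Lemma Phi_inj m (pi sigma : 'S_m) (H K : seq (hook m)) :
    laminar_hooks pi H -> laminar_hooks sigma K -> Phi (pi, H) = Phi (sigma, K) ->
  (pi, H) = (sigma, K).
Proof.
move=> lH lK; rewrite /Phi /= => -[erho ealpha].
have fI := min_hat_inj lH; have gI := min_hat_inj lK.
have fg := min_hat_good lH; have gg := min_hat_good lK.
have rf := min_hat_reading lH; have rg := min_hat_reading lK.
rewrite -erho in gI gg rg.
have eqfg : {in color_partition pi H &, forall B C,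
    (min_hat pi B < min_hat pi C) = (min_hat sigma B < min_hat sigma C)}.
  apply: good_order_unique => //; first exact: color_partitionP.
  move=> B C cg; rewrite -(color_orientation_lt cg) ealpha color_orientation_lt //.
  by rewrite -erho.
have epi : pi = sigma.
  exact: (reading_order_unique (color_partitionP pi H) fI eqfg rf rg).
(* The hooks have the same southwest endpoints, the descents. The entry after a descent has the
   color of its hook, so the maximum of its block is the northeast endpoint. *)
subst sigma; congr pair; apply: eq_from_map_fst.
  by case: lH => -> _ _ _; case: lK.
move=> h k hH kK e1.
have [q qh [_ eqh _]] := hook_block lH hH.
have [q' qk [_ eqk _]] := hook_block lK kK.
have eq' : q = q' by apply: val_inj; rewrite /= qh qk e1.
have := hi_block_some lH eqh; rewrite erho eq' (hi_block_some lK eqk).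
move=> /lift_inj/perm_inj e2.
by rewrite [h]surjective_pairing [k]surjective_pairing e1 e2.
Qed.

(** * Surjectivity *)

Section Greedy.
Variables (T : finType) (e : rel T) (w : T -> nat).
Hypothesis acyc : forall c, path.cycle e c -> c = [::].

(** Take [y] with the fewest ancestors: a predecessor of [y] in [S] would have strictly fewer, as
    [y] is not one of them. *)
Lemma acyclic_source (S : {set T}) x : x \in S ->
  exists2 y, y \in S & forall z, z \in S -> ~~ e z y.
Proof.
move=> xS.
have [y yS ymin] := @argmin_exists _ (fun y => y \in S)
  (fun y => #|[set z | connect e z y]%SET|) x xS.
exists y => // z zS; apply/negP => zy.
have := ymin z zS; apply/negP; rewrite -ltnNge; apply: proper_card.
apply/properP; split.
  by apply/fintype.subsetP => t; rewrite !inE => /connect_trans; apply;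
    exact: connect1.
exists y; rewrite inE ?connect0 //; apply/negP => /connectP[p yp lz].
have := acyc (c := y :: p); rewrite /= rcons_path yp -lz zy.
by move=> /(_ isT).
Qed.

(** Remove at each step a source of least weight. In the last clause [y] is already a source when
    [x] is removed, so [x] was preferred to it. *)
Lemma greedy_order (S : {set T}) : exists f : T -> nat,
  [/\ {in S &, injective f},
      {in S &, forall x y, e x y -> f x < f y}
    & {in S &, forall x y, f x <= f y ->
        (forall z, z \in S -> f x <= f z -> ~~ e z y) -> w x <= w y}].
Proof.
have [k] := ubnP #|S|; elim: k S => // k IH S Sk.
have [->|[x xS]] := set_0Vmem S.
  by exists (fun=> 0); split=> x y; rewrite inE.
have [s sS ssrc] := acyclic_source xS.
pose src y := (y \in S) && [forall z in S, ~~ e z y].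
have src_s : src s by rewrite /src sS; apply/forall_inP.
have [b /andP[bS /forall_inP bsrc] bmin] := argmin_exists w src_s.
have [|f [fI fe fw]] := IH (S :\ b)%SET.
  by move: Sk; rewrite (cardsD1 b) bS.
exists (fun y => if y == b then 0 else (f y).+1); split=> y z yS zS.
- have [->|yb] := eqVneq y b; have [->|zb] := eqVneq z b => //.
  by move=> [] /fI; apply; rewrite !inE ?yb ?zb.
- have [->|zb] := eqVneq z b; first by move=> eyb; have := bsrc _ yS; rewrite eyb.
  have [->|yb] := eqVneq y b => //.
  by rewrite ltnS; apply: fe; rewrite !inE ?yb ?zb.
have [->|yb] := eqVneq y b.
  move=> _ zsrc; apply: bmin; rewrite /src zS; apply/forall_inP => t tS.
  exact: zsrc.
have [->|zb] := eqVneq z b => //; rewrite ltnS => yz zsrc.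
apply: fw => //; rewrite ?inE ?yb ?zb // => t; rewrite !inE => /andP[tb tS] yt.
by apply: zsrc => //; rewrite (negbTE tb).
Qed.

End Greedy.

(** * The greedy order is good *)

Section Lexicographic.
Variables (m : nat) (rho : {set {set 'I_m.+1}}) (alpha : arcs m.+1).
Hypothesis P : Ptilde_c (rho, alpha).
Local Notation blk := (finset.pblock rho).

Lemma crossing_inside (C D : {set 'I_m.+1}) : crossing C D ->
  exists2 x, x \in D & lo C < x < hi C.
Proof.
case/crossingP=> i [k [j [l [iC kC jD lD]]]] H; exists j => //.
by move: (lo_le iC) (lo_le kC) (hi_ge iC) (hi_ge kC) H; lia.
Qed.

Lemma good_order_exists : exists f, [/\ {in rho &, injective f},
  good_order rho f & forall B C, crossing_graph rho B C ->
    ((B, C) \in alpha) = (f B < f C)].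
Proof.
case: P => /= rhoP _ [asub atot] acyc src.
have [f [fI fe fw]] := greedy_order (fun B => val (hi B)) acyc rho.
have fcg B C : crossing_graph rho B C -> ((B, C) \in alpha) = (f B < f C).
  move=> cg; have /and4P[Br Cr _ _] := cg.
  apply/idP/idP; first exact: fe.
  have := atot _ _ cg; case: ((B, C) \in alpha) => //= CB.
  by rewrite ltnNge ltnW // fe.
exists f; split=> // C Cr C0.
have rootr : blk ord_max \in rho by apply: blk_in.
(* The first block of the order receives no arc, so it is the only source. *)
have froot : f (blk ord_max) < f C.
  have [b br bmin] := @argmin_exists _ (fun B => B \in rho) f C Cr.
  have : b \in sources rho alpha.
    rewrite inE br; apply/eqP/eq_card0 => D; rewrite !inE; apply/negP => Db.
    have /and4P[Dr _ _ _] := asub _ _ Db.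
    by have := bmin _ Dr; rewrite leqNgt fe.
  rewrite src inE => /eqP eb; rewrite ltn_neqAle -eb bmin // andbT.
  apply: contraNneq C0 => /fI <- //; rewrite eb; exact: mem_blk.
(* Let [b] be the last block before [C] that reaches above [lo C]; the block of n is a candidate.
   The blocks between [b] and [C] end too low to pop an entry above [lo C], so any entry of [b]
   inside [C] is a witness. *)
have [|b /and3P[br bC lob] bmax] := @argmax_exists _
  (fun b => [&& b \in rho, f b < f C & lo C < hi b]) f (blk ord_max).
  rewrite rootr froot /=; apply: leq_trans (hi_ge (mem_blk rhoP ord_max)).
  rewrite ltn_neqAle -ltnS ltn_ord andbT; apply: contraNneq C0 => /val_inj <-.
  exact: lo_in Cr.
have below D : D \in rho -> f b < f D -> f D < f C -> hi D <= lo C.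
  move=> Dr bD DC; rewrite leqNgt; apply/negP => lt.
  by have := bmax D; rewrite Dr DC lt leqNgt bD => /(_ isT).
case: (boolP [exists x in b, lo C < x < hi C]) => [/exists_inP[x xb xC]|no].
  exists x; rewrite (blk_eq rhoP br xb); split=> // D Dr bD DC.
  by apply: leq_ltn_trans (below _ Dr bD DC) _; case/andP: xC.
move/exists_inPn in no.
(* If [b] had no entry inside [C], no block from [b] on would have an arc to [C], so the greedy
   choice of [b] would give this inequality. But then [hi b] is itself inside [C]. *)
have : hi b <= hi C.
  apply: fw => //; first exact: ltnW.
  move=> z zr bz; apply/negP => zC; have cg := asub _ _ zC.
  rewrite fcg // in zC; case/and4P: cg => _ _ _.
  rewrite crossing_sym => /crossing_inside[x xz xC].
  have [eb|nb] := eqVneq z b; first by have := no x; rewrite -eb xC => /(_ xz).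
  have {}bz : f b < f z.
    by rewrite ltn_neqAle bz andbT; apply: contra_neq nb => /esym/fI ->.
  have := below _ zr bz zC; have := hi_ge xz; case/andP: xC => + _.
  lia.
rewrite leq_eqVlt => /predU1P[/val_inj/(hi_inj rhoP br Cr) e|lt].
  by rewrite e ltnn in bC.
by have := no _ (hi_in rhoP br); rewrite lob lt.
Qed.

End Lexicographic.

(** * The permutation built from an order *)

Lemma rank_perm m (k : 'I_m -> nat) : injective k ->
  exists s : 'S_m, forall a b, (s a < s b) = (k a < k b).
Proof.
move=> kI; pose below a := [set b : 'I_m | k b < k a]%SET.
have rk a : #|below a| < m.
  suff : #|below a| < #|[set: 'I_m]%SET| by rewrite cardsT card_ord.
  apply: proper_card; apply/properP.
  split; first by apply/fintype.subsetP => b; rewrite inE.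
  by exists a; rewrite !inE ?ltnn.
have mono a b : k a < k b -> #|below a| < #|below b|.
  move=> ab; apply: proper_card; apply/properP; split.
    by apply/fintype.subsetP => c; rewrite !inE => /ltn_trans; apply.
  by exists a; rewrite !inE ?ltnn.
have rkE a b : (#|below a| < #|below b|) = (k a < k b).
  apply/idP/idP; last exact: mono.
  have [//|/mono lt|/kI->] := ltngtP (k a) (k b); last by rewrite ltnn.
  by rewrite ltnNge ltnW.
have inj : injective (fun a => Ordinal (rk a)).
  move=> a b [e]; apply: kI; have := rkE a b; have := rkE b a.
  by rewrite e ltnn; case: ltngtP.
by exists (perm inj) => a b; rewrite !permE /= rkE.
Qed.

Section Build.
Variables (m : nat) (rho : {set {set 'I_m.+1}}) (f : {set 'I_m.+1} -> nat).
Hypothesis rhoP : finset.partition rho [set: 'I_m.+1]%SET.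
Local Notation blk := (finset.pblock rho).

(* Entries leave the stack in runs: [u] is read just before the first block
   that arrives after that of [u] and has a greater maximum. *)
Let bound : nat := (\max_(D in rho) f D).+1.
Let run (u : 'I_m.+1) : nat :=
  \big[minn/bound]_(D in rho | (f (blk u) < f D) && (u < hi D)) f D.
(** The pair of run and value in lexicographic order, coded in base [m.+1]. Entries that no later
    block exceeds form the final run, numbered [bound]. *)
Let key (u : 'I_m.+1) : nat := run u * m.+1 + u.

Lemma run_le u D : D \in rho -> f (blk u) < f D -> u < hi D -> run u <= f D.
Proof.
move=> Dr uD Du; apply: bigmin_seq_le; first by rewrite mem_index_enum.
by rewrite Dr uD.
Qed.

Lemma run_ge u t : t <= bound ->
    (forall D, D \in rho -> f (blk u) < f D -> u < hi D -> t <= f D) ->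
  t <= run u.
Proof.
move=> tb tD; apply: (big_ind (leq t)) => // [x y|D /and3P[]]; last exact: tD.
by rewrite leq_min => ->.
Qed.

Lemma run_bound u : run u <= bound.
Proof.
rewrite /run; apply: (big_ind (fun x => x <= bound)) => // [x y xb _|D].
  by apply: leq_trans xb; apply: geq_minl.
by case/andP=> Dr _; apply: leqW; apply: leq_bigmax_cond.
Qed.

Lemma run_block u : f (blk u) < run u.
Proof.
by apply: run_ge => // ; rewrite ltnS; apply: leq_bigmax_cond; apply: blk_in.
Qed.

Lemma key_run u v : run u < run v -> key u < key v.
Proof.
move=> uv; apply: (@leq_trans ((run u).+1 * m.+1)).
  by rewrite /key mulSn addnC ltn_add2r.
by apply: leq_trans (leq_addr _ _); rewrite leq_mul2r uv.
Qed.

Lemma key_lt (u v : 'I_m.+1) : run u <= run v -> u < v -> key u < key v.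
Proof.
rewrite leq_eqVlt => /predU1P[e uv|/key_run //].
by rewrite /key e ltn_add2l.
Qed.

Lemma key_inj : injective key.
Proof.
move=> u v /(congr1 (modn^~ m.+1)); rewrite /key !modnMDl !modn_small //.
exact: val_inj.
Qed.

Lemma key_same u v : blk u = blk v -> (key u < key v) = (u < v).
Proof.
have lt (x y : 'I_m.+1) : blk x = blk y -> x < y -> key x < key y.
  move=> exy xy; apply: key_lt => //; apply: run_ge; first exact: run_bound.
  by move=> D Dr yD Dy; apply: run_le => //; [rewrite exy | apply: ltn_trans Dy].
move=> e; have [uv|vu|/val_inj->] := ltngtP u v; last by rewrite ltnn.
  by rewrite lt.
by apply/negbTE; rewrite -leqNgt ltnW // lt.
Qed.

(** A block up to that of [v] that exceeds [u] closes the run of [u] before [v]. If there is none,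
    each block that can close the run of [u] comes after that of [v] and also exceeds [v], so [v]
    has no later run and a smaller value. *)
Lemma key_cross u v : f (blk u) < f (blk v) ->
  (key v < key u) =
  [forall D in rho, (f (blk u) < f D) && (f D <= f (blk v)) ==> (hi D < u)].
Proof.
move=> uv; apply/idP/forall_inP => [vu D Dr|Hall].
  apply/implyP => /andP[uD Dv]; rewrite ltnNge; apply: contraL vu.
  rewrite leq_eqVlt => /predU1P[/val_inj e|Du].
    by rewrite e (blk_hi rhoP Dr) ltnn in uD.
  rewrite -leqNgt ltnW //; apply: key_run.
  apply: leq_ltn_trans (run_le Dr uD Du) _.
  exact: leq_ltn_trans Dv (run_block _).
have vu : v < u.
  apply: leq_ltn_trans (hi_ge (mem_blk rhoP v)) _.
  by have := Hall _ (blk_in rhoP v); rewrite uv leqnn.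
apply: key_lt => //; apply: run_ge; first exact: run_bound.
move=> D Dr uD Du; apply: run_le => //; last exact: ltn_trans Du.
rewrite ltnNge; apply/negP => Dv.
by have := Hall _ Dr; rewrite uD Dv ltnNge (ltnW Du).
Qed.

Lemma reading_order_exists : exists pi : 'S_m, reading_order rho f pi.
Proof.
have [|s sE] := @rank_perm m (fun a => key (lift ord_max a)).
  by move=> a b /key_inj/lift_inj.
exists s^-1%g => i j u v B C.
have ltE (x y : 'I_m) : (x < y) =
    (key (lift ord_max (s^-1%g x)) < key (lift ord_max (s^-1%g y))).
  by rewrite -sE !permKV.
by split=> [e|lt]; rewrite ltE; [exact: key_same | exact: key_cross].
Qed.

End Build.

(** * The hooks built from a good order *)

Section HooksOfOrder.
Variables (m : nat) (rho : {set {set 'I_m.+1}}) (f : {set 'I_m.+1} -> nat).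
Variable pi : 'S_m.
Hypothesis rhoP : finset.partition rho [set: 'I_m.+1]%SET.
Hypothesis fI : {in rho &, injective f}.
Hypothesis fgood : good_order rho f.
Hypothesis reading : reading_order rho f pi.
Local Notation blk := (finset.pblock rho).
Local Notation pt i := (lift ord_max (pi i)).
Implicit Types (C D : {set 'I_m.+1}) (i j p q : 'I_m).

(** The earliest block finds no entry to straddle, so it must contain n. *)
Lemma root_first D : D \in rho -> f (blk ord_max) <= f D.
Proof.
move=> Dr; have [B Br Bmin] := @argmin_exists _ (fun B => B \in rho) f D Dr.
suff /(blk_eq rhoP Br)-> : ord_max \in B by apply: Bmin.
apply: contraT => B0; have [x [_ lt _]] := fgood Br B0.
by have := Bmin _ (blk_in rhoP x); rewrite leqNgt lt.
Qed.

Lemma nonroot_after B D : B \in rho -> D \in rho -> f B < f D -> ord_max \notin D.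
Proof.
move=> Br Dr BD; apply: contraL BD => nD.
by rewrite -leqNgt -(blk_eq rhoP Dr nD) root_first.
Qed.

Lemma read_same i j : blk (pt i) = blk (pt j) -> (i < j) = (pt i < pt j).
Proof. exact: (reading i j).1. Qed.

Lemma read_cross i j : f (blk (pt i)) < f (blk (pt j)) ->
  (j < i) = [forall D in rho, (f (blk (pt i)) < f D) && (f D <= f (blk (pt j)))
                ==> (hi D < pt i)].
Proof. exact: (reading i j).2. Qed.

Lemma read_crossP i j : f (blk (pt i)) < f (blk (pt j)) ->
  reflect (forall D, D \in rho -> f (blk (pt i)) < f D ->
             f D <= f (blk (pt j)) -> hi D < pt i)
          (j < i).
Proof.
move=> ij; rewrite read_cross //; apply: (iffP forall_inP) => Hall D Dr.
  by move=> iD Dj; have := Hall _ Dr; rewrite iD Dj.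
by apply/implyP => /andP[iD Dj]; apply: Hall.
Qed.

Lemma pt_of (v : 'I_m.+1) : v != ord_max -> exists i, v = pt i.
Proof. by case: (valueP pi v) => [->|//]; rewrite eqxx. Qed.

Lemma pt_lt (v w : 'I_m.+1) : v < w -> exists i, v = pt i.
Proof.
move=> vw; apply: pt_of; apply: contraTneq vw => ->.
by rewrite -leqNgt -ltnS ltn_ord.
Qed.

Lemma pt_in C v : ord_max \notin C -> v \in C -> exists i, v = pt i.
Proof. by move=> C0 vC; apply: pt_of; apply: contraNneq C0 => <-. Qed.

(** If an entry of a later block preceded [lo C], the block [W] next after [C] would lie entirely
    below [lo C]. But [W] straddles an entry of [C], or an older one that exceeds [hi C]; neither
    fits below [hi W]. *)
Lemma lo_first C q i : C \in rho -> lo C = pt q -> f C < f (blk (pt i)) -> q < i.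
Proof.
move=> Cr loC Ci; rewrite ltnNge; apply/negP; rewrite leq_eqVlt.
have qC : blk (pt q) = C by rewrite -loC blk_lo.
case/predU1P=> [/val_inj e|]; first by rewrite e qC ltnn in Ci.
have Ci' := Ci; rewrite -{1}qC in Ci'.
move/(read_crossP Ci'); rewrite qC => Hall.
have [|W /andP[Wr CW] Wmin] := @argmin_exists _
  (fun W => (W \in rho) && (f C < f W)) f (blk (pt i)).
  by rewrite blk_in.
have hW : hi W < lo C.
  rewrite loC; apply: Hall => //; apply: Wmin; by rewrite blk_in.
have [x [xW fx xmax]] := fgood Wr (nonroot_after Cr Wr CW).
have : f (blk x) <= f C.
  rewrite leqNgt; apply/negP => Cx.
  by have := Wmin (blk x); rewrite blk_in // Cx leqNgt fx => /(_ isT).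
rewrite leq_eqVlt => /predU1P[/fI|xC].
  move=> /(_ (blk_in rhoP x) Cr) e.
  have := lo_le (mem_blk rhoP x); rewrite e; case/andP: xW => _ xW.
  by rewrite leqNgt (ltn_trans xW hW).
have := xmax _ Cr xC CW; have := hi_ge (lo_in rhoP Cr); case/andP: xW; lia.
Qed.

(** Goodness provides some straddled entry, at position [k]; the point is that the entry read
    immediately before [C] is straddled too. This creates the descent and leaves room for the
    hook. *)
Lemma before_block C q : C \in rho -> ord_max \notin C -> lo C = pt q ->
  exists p, [/\ val q = p.+1, lo C < pt p & pt p < hi C].
Proof.
move=> Cr C0 loC; have [x [xC fx xmax]] := fgood Cr C0.
case/andP: xC => lox xhi; have [k ek] := pt_lt xhi.
rewrite {}ek in lox xhi fx xmax.
have qC : blk (pt q) = C by rewrite -loC blk_lo.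
have kq : k < q.
  have kqf : f (blk (pt k)) < f (blk (pt q)) by rewrite qC.
  have /negP nqk : ~ q < k.
    move/(read_crossP kqf)/(_ C Cr fx); rewrite qC leqnn => /(_ isT).
    by rewrite ltnNge (ltnW xhi).
  rewrite ltn_neqAle leqNgt nqk andbT; apply: contraTneq kqf => /val_inj->.
  by rewrite ltnn.
have pm : q.-1 < m by apply: leq_ltn_trans (leq_pred _) (ltn_ord q).
pose p := Ordinal pm; have qp : val q = p.+1.
  by rewrite /= prednK //; apply: leq_ltn_trans kq.
have pq : p < q by rewrite [X in _ < X]qp.
have kp : k <= p by rewrite -ltnS -qp.
have pC : f (blk (pt p)) < f C.
  have [//|Cp|/fI e] := ltngtP (f (blk (pt p))) (f C).
    by have := lo_first Cr loC Cp; rewrite ltnNge ltnW.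
  have {}e : blk (pt p) = C by apply: e => //; apply: blk_in.
  have := lo_le (mem_blk rhoP (pt p)); rewrite e loC leqNgt -read_same ?pq //.
  by rewrite qC.
(* By [lo_first], [D] has started before [C], hence before [p]; as [pt p] is read after that, [D]
   does not pop it. *)
have between D : D \in rho -> f (blk (pt p)) < f D -> f D < f C -> hi D < pt p.
  move=> Dr pD DC; rewrite ltnNge; apply/negP => le.
  have [d loD] := pt_in (nonroot_after (blk_in rhoP _) Dr pD) (lo_in rhoP Dr).
  have dD : blk (pt d) = D by rewrite -loD blk_lo.
  have dq : d < q by apply: (lo_first Dr loD); rewrite qC.
  have pd : f (blk (pt p)) < f (blk (pt d)) by rewrite dD.
  have : d < p.
    rewrite ltn_neqAle -ltnS -qp dq andbT; apply: contraTneq pd => /val_inj->.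
    by rewrite ltnn.
  by move/(read_crossP pd)/(_ D Dr pD); rewrite dD leqnn ltnNge le => /(_ isT).
exists p; split=> //; last first.
  have pqf : f (blk (pt p)) < f (blk (pt q)) by rewrite qC.
  rewrite ltnNge; apply/negP => Cp.
  have : ~~ (q < p) by rewrite -leqNgt ltnW.
  move/(read_crossP pqf); apply=> D Dr pD; rewrite qC leq_eqVlt.
  case/predU1P=> [/fI eD|]; last exact: between.
  rewrite eD // ltn_neqAle Cp andbT; apply: contraTneq pC => /val_inj e.
  by rewrite -e blk_hi // ltnn.
(* If [pt p] were below [lo C], it would be smaller than the straddled entry at [k] and read after
   it; each of the three orders of their blocks excludes this. *)
rewrite ltnNge; apply/negP => pl.
have {}kp : k < p.
  rewrite ltn_neqAle kp andbT; apply: contraTneq lox => /val_inj->.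
  by rewrite -leqNgt.
have [kpf|pkf|/fI e] := ltngtP (f (blk (pt k))) (f (blk (pt p))).
- have : ~~ (p < k) by rewrite -leqNgt ltnW.
  move/(read_crossP kpf); apply=> D Dr kD Dp; apply: xmax => //.
  exact: leq_ltn_trans Dp pC.
- have := read_crossP pkf kp; move=> /(_ (blk (pt k)) (blk_in rhoP _) pkf (leqnn _)).
  rewrite ltnNge => /negP[]; apply/ltnW/(leq_ltn_trans pl)/(leq_trans lox).
  exact/hi_ge/mem_blk.
- have := @read_same k p; rewrite kp e ?blk_in // => /(_ erefl)/esym.
  by rewrite ltnNge (leq_trans pl (ltnW lox)).
Qed.

(** Conversely to [before_block], each descent starts a block. An earlier entry of [C] would be read
    before [p]; since an entry of an older block precedes or follows all of [C], and a newer block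
    read at [p] would have to end below [pt q], no block is left for [pt p]. *)
Lemma descent_block p q : val q = p.+1 -> pt q < pt p ->
  lo (blk (pt q)) = pt q /\ ord_max \notin blk (pt q).
Proof.
move=> qp vu; set C := blk (pt q); have Cr : C \in rho by apply: blk_in.
have pq : p < q by rewrite [X in _ < X]qp.
have npq : blk (pt p) <> C.
  by move=> e; have := read_same e; rewrite pq ltnNge ltnW.
have loC : lo C = pt q.
  apply/val_inj/eqP; rewrite eqn_leq lo_le ?mem_blk // leqNgt; apply/negP => lt.
  have [k ek] := pt_lt lt; rewrite ek in lt.
  have kC : blk (pt k) = C by rewrite -ek blk_lo.
  have kq : k < q by rewrite read_same.
  have kp : k < p.
    rewrite ltn_neqAle -ltnS -qp kq andbT; apply: contraTneq lt => /val_inj->.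
    by rewrite -leqNgt ltnW.
  have [pC|Cp|/fI] := ltngtP (f (blk (pt p))) (f C).
  - have : q < p by rewrite read_cross // -/C -kC -read_cross // kC.
    by rewrite ltnNge ltnW.
  - have := read_crossP Cp pq; move=> /(_ _ (blk_in rhoP _) Cp (leqnn _)).
    rewrite ltnNge => /negP[]; apply/ltnW/(leq_trans vu)/hi_ge/mem_blk => //.
  - by move=> /(_ (blk_in rhoP _) Cr).
split=> //; apply/negP => C0; have := root_first (blk_in rhoP (pt p)).
rewrite (blk_eq rhoP Cr C0) leq_eqVlt => /predU1P[/fI e|Cp].
  by apply/npq/esym/e => //; apply: blk_in.
by have := lo_first Cr loC Cp; rewrite ltnNge ltnW.
Qed.

(** The endpoints are forced: a color class is increasing, begins just after the southwest endpoint
    and ends at the northeast one. *)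
Definition hook_of C (h : hook m) : Prop :=
  [/\ C \in rho, ord_max \notin C,
      exists2 q, lo C = pt q & val q = (val h.1).+1 & pt h.2 = hi C].

Lemma hook_of_fun C h h' : hook_of C h -> hook_of C h' -> h = h'.
Proof.
move=> [_ _ [q loC q1] hC] [_ _ [q' loC' q1'] hC'].
have /lift_inj/perm_inj e2 : pt h.2 = pt h'.2 by rewrite hC.
have /lift_inj/perm_inj e1 : pt q = pt q' by rewrite -loC.
rewrite [h]surjective_pairing [h']surjective_pairing e2; congr pair.
by apply/val_inj/eqP; rewrite -eqSS /= -q1 e1 q1'.
Qed.

Lemma hook_of_inj C D h : hook_of C h -> hook_of D h -> C = D.
Proof.
by move=> [Cr _ _ hC] [Dr _ _ hD]; apply: (hi_inj rhoP); rewrite // -hC.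
Qed.

Lemma hook_of_exists C : C \in rho -> ord_max \notin C ->
  exists2 h, hook_of C h & descent pi h.1.
Proof.
move=> Cr C0; have [q loC] := pt_in C0 (lo_in rhoP Cr).
have [e eC] := pt_in C0 (hi_in rhoP Cr).
have [p [qp lop _]] := before_block Cr C0 loC.
exists (p, e); first by split=> //; exists q.
by apply/existsP; exists q; rewrite qp eqxx -!(val_pt pi) -loC.
Qed.

Lemma hook_of_descent p : descent pi p -> exists C h, hook_of C h /\ h.1 = p.
Proof.
case/existsP=> q /andP[/eqP qp qlt]; have qlt' : pt q < pt p by rewrite !val_pt.
have [loC C0] := descent_block qp qlt'.
have Cr := blk_in rhoP (pt q); have [e eC] := pt_in C0 (hi_in rhoP Cr).
by exists (blk (pt q)), (p, e); split=> //; split=> //; exists q.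
Qed.

Lemma order_hooks_exist : exists H : seq (hook m),
  [/\ map fst H = descents pi,
      (forall h, h \in H -> exists C, hook_of C h)
    & (forall C, C \in rho -> ord_max \notin C -> exists2 h, h \in H & hook_of C h)].
Proof.
have [H [eH H1]] : exists H : seq (hook m), map fst H = descents pi /\
    (forall h, h \in H -> exists C, hook_of C h).
  have : {subset descents pi <= descent pi}.
    by move=> p; rewrite mem_filter => /andP[].
  elim: (descents pi) => [|p s IH] sub; first by exists [::].
  have [|H [eH H1]] := IH.
    by move=> r rs; apply: sub; rewrite inE rs orbT.
  have [C [h [Ch hp]]] := hook_of_descent (sub p (mem_head _ _)).
  exists (h :: H); rewrite /= hp eH; split=> // k.
  by rewrite inE => /predU1P[->|/H1//]; exists C.
exists H; split=> // C Cr C0.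
have [h Ch hd] := hook_of_exists Cr C0; exists h => //.
have : h.1 \in map fst H by rewrite eH mem_filter hd mem_enum.
case/mapP=> k kH e1; have [D Dk] := H1 _ kH.
have [_ _ [q loC qh] _] := Ch; have [Dr _ [r loD rk] _] := Dk.
have eqr : q = r by apply: val_inj; rewrite /= qh rk e1.
have eCD : C = D by rewrite -(blk_lo rhoP Cr) loC eqr -loD blk_lo.
by rewrite eCD in Ch; rewrite (hook_of_fun Ch Dk).
Qed.

(** An entry of an older block is read before all of [C] or after all of [C], never in between. *)
Lemma covers_after C h i : hook_of C h -> covers h i -> f C <= f (blk (pt i)).
Proof.
move=> [Cr _ [q loC qh] hC] /andP[hi1 ih]; rewrite leqNgt; apply/negP => iC.
have qC : blk (pt q) = C by rewrite -loC blk_lo.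
have hC' : blk (pt h.2) = C by rewrite hC blk_hi.
have qi : q <= i by rewrite qh.
have : q < i.
  rewrite ltn_neqAle qi andbT; apply: contraTneq iC => /val_inj<-.
  by rewrite qC ltnn.
by rewrite read_cross ?qC // -hC' -read_cross ?hC' // ltnNge ih.
Qed.

Lemma covers_own C h i : hook_of C h -> blk (pt i) = C -> covers h i.
Proof.
move=> [Cr _ [q loC qh] hC] iC.
have qC : blk (pt q) = C by rewrite -loC blk_lo.
have hC' : blk (pt h.2) = C by rewrite hC blk_hi.
have iC' : pt i \in C by rewrite -iC mem_blk.
rewrite /covers -qh; apply/andP; split; rewrite leqNgt read_same ?hC' ?qC //.
  by rewrite -leqNgt -loC lo_le.
by rewrite -leqNgt hC hi_ge.
Qed.

Section Hooks.
Variable H : seq (hook m).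
Hypothesis H_fst : map fst H = descents pi.
Hypothesis H_block : forall h, h \in H -> exists C, hook_of C h.
Hypothesis block_H :
  forall C, C \in rho -> ord_max \notin C -> exists2 h, h \in H & hook_of C h.

Lemma order_laminar : laminar_hooks pi H.
Proof.
split=> // [h hH|h hH l /andP[hl lh]|h h' hH h'H hh' h'h].
- have [C Ch] := H_block hH; have [Cr C0 [q loC qh] hC] := Ch.
  have [p [qp _ phi]] := before_block Cr C0 loC.
  have ep : h.1 = p by apply/val_inj/eqP; rewrite -eqSS /= -qh qp.
  have /andP[h12 _] : covers h h.2 by apply: (covers_own Ch); rewrite hC blk_hi.
  by rewrite /is_hook h12 -!(val_pt pi) hC ep.
- have [C Ch] := H_block hH; have [Cr C0 [q loC qh] hC] := Ch.
  have hC' : blk (pt h.2) = C by rewrite hC blk_hi.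
  (* An entry under the hook belongs to [C] or to a later block; in the latter case, being read
     before [hi C], it lies in a block with maximum below [hi C]. *)
  have cl : covers h l by rewrite /covers hl ltnW.
  have := covers_after Ch cl; rewrite -!(val_pt pi) leq_eqVlt.
  case/predU1P=> [/fI e|Cl].
    by rewrite -read_same // hC' e // blk_in.
  rewrite hC; apply: leq_ltn_trans (hi_ge (mem_blk rhoP _)) _.
  have hlf : f (blk (pt h.2)) < f (blk (pt l)) by rewrite hC'.
  have := read_crossP hlf lh; rewrite hC' hC; apply => //; exact: blk_in.
have [C Ch] := H_block hH; have [Cr C0 [q loC qh] hC] := Ch.
have [D Dh'] := H_block h'H; have [Dr D0 [r loD rh'] hD] := Dh'.
have rD : blk (pt r) = D by rewrite -loD blk_lo.
have hD' : blk (pt h'.2) = D by rewrite hD blk_hi.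
have hC' : blk (pt h.2) = C by rewrite hC blk_hi.
have cr : covers h r by rewrite /covers rh' h'h (leq_trans hh').
have := covers_after Ch cr; rewrite rD leq_eqVlt => /predU1P[/fI e|CD].
  have eCD := e Cr Dr; rewrite -eCD in Dh'.
  by rewrite (hook_of_fun Ch Dh') ltnn in hh'.
(* Since [hi C] is read after the first entry of the later block [D], it is read after all of [D],
   in particular after the end of [h']. *)
have : r < h.2.
  rewrite ltn_neqAle rh' h'h andbT -rh'.
  apply: contraTneq CD => /val_inj e; by rewrite -rD e hC' ltnn.
have hr : f (blk (pt h.2)) < f (blk (pt r)) by rewrite hC' rD.
have hh2 : f (blk (pt h.2)) < f (blk (pt h'.2)) by rewrite hC' hD'.
by rewrite (read_cross hr) rD -hD' -(read_cross hh2).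
Qed.

Lemma order_color_root i : ord_max \in blk (pt i) -> point_color pi H i = None.
Proof.
move=> ri; case: (point_color_cases order_laminar i) => [[]//|[h [_ hH hi _]]].
have [C Ch] := H_block hH; have [Cr C0 _ _] := Ch.
have := covers_after Ch hi.
rewrite -(blk_eq rhoP (blk_in rhoP _) ri) leqNgt ltn_neqAle root_first // andbT.
by rewrite negbK => /eqP/fI e; rewrite -e ?mem_blk ?blk_in in C0.
Qed.

Lemma order_color_hook i h : h \in H -> hook_of (blk (pt i)) h ->
  point_color pi H i = Some h.
Proof.
move=> hH Ch; apply: (point_color_innermost order_laminar) => //.
  exact: covers_own Ch _.
move=> h' h'H h'i; have [C' Ch'] := H_block h'H.
have [Cr C0 [q loC qh] hC] := Ch; have [Cr' C0' [q' loC' qh'] hC'] := Ch'.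
(* Any other hook covering [i] belongs to an older block, which starts earlier by [lo_first]. *)
have := covers_after Ch' h'i; rewrite leq_eqVlt => /predU1P[/fI e|lt].
  by rewrite -(e Cr' Cr) in Ch; rewrite (hook_of_fun Ch Ch').
rewrite -ltnS -qh -ltnS -qh' ltnS ltnW //.
by apply: (lo_first Cr' loC'); rewrite -loC blk_lo.
Qed.

Lemma order_value_color v :
  (ord_max \in blk v /\ value_color pi H v = None) \/
  (exists h, [/\ hook_of (blk v) h, h \in H & value_color pi H v = Some h]).
Proof.
have [->|[i ->]] := valueP pi v.
  by left; rewrite value_color_max mem_blk.
rewrite value_color_pt; have [ri|ri] := boolP (ord_max \in blk (pt i)).
  by left; rewrite order_color_root.
have [h hH Ch] := block_H (blk_in rhoP _) ri.
by right; exists h; split=> //; apply: order_color_hook.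
Qed.

Lemma order_color_eq u v :
  (value_color pi H u == value_color pi H v) = (blk u == blk v).
Proof.
apply/eqP/eqP => [|e].
  have [[ru ->]|[h [Ch _ ->]]] := order_value_color u;
    have [[rv ->]|[h' [Ch' _ ->]]] := order_value_color v => //.
    by rewrite -(blk_eq rhoP (blk_in rhoP _) ru) -(blk_eq rhoP (blk_in rhoP _) rv).
  by move=> [e]; rewrite e in Ch; apply: hook_of_inj Ch Ch'.
have [[ru ->]|[h [Ch _ ->]]] := order_value_color u;
  have [[rv ->]|[h' [Ch' _ ->]]] := order_value_color v => //.
- by case: Ch' => _ C0; rewrite -e ru in C0.
- by case: Ch => _ C0; rewrite e rv in C0.
- by rewrite e in Ch; rewrite (hook_of_fun Ch Ch').
Qed.

Lemma order_color_partition : color_partition pi H = rho.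
Proof.
have cP := color_partitionP pi H.
have eqb u : finset.pblock (color_partition pi H) u = blk u.
  apply/setP => v; rewrite mem_color_block order_color_eq.
  apply/eqP/idP => [->|vu]; first exact: mem_blk.
  by rewrite (blk_eq rhoP (blk_in rhoP u) vu).
apply/setP => B; apply/idP/idP => Br.
  have [x xB] := block_inhabited cP Br.
  by rewrite -(blk_eq cP Br xB) eqb blk_in.
have [x xB] := block_inhabited rhoP Br.
by rewrite -(blk_eq rhoP Br xB) -eqb blk_in.
Qed.

Lemma order_min_hat :
  {in rho &, forall B C, (min_hat pi B < min_hat pi C) = (f B < f C)}.
Proof.
have mh v : min_hat pi (blk v) = color_start (value_color pi H v).
  by rewrite -(min_hat_block order_laminar) order_color_partition.
have lt B C : B \in rho -> C \in rho -> f B < f C -> min_hat pi B < min_hat pi C.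
  move=> Br Cr BC.
  have [u uB] := block_inhabited rhoP Br; have [v vC] := block_inhabited rhoP Cr.
  rewrite -(blk_eq rhoP Br uB) -(blk_eq rhoP Cr vC) !mh.
  have [[]|[h [Ch _ ->]]] := order_value_color v.
    by rewrite (blk_eq rhoP Cr vC) (negbTE (nonroot_after Br Cr BC)).
  have [[_ ->] //|[h' [Ch' _ ->]] /=] := order_value_color u.
  case: Ch => _ _ [q loq <-] _; case: Ch' => _ _ [q' loq' <-] _.
  apply: (lo_first (blk_in rhoP u) loq').
  by rewrite -loq blk_lo ?blk_in // (blk_eq rhoP Br uB) (blk_eq rhoP Cr vC).
move=> B C Br Cr; have [BC|CB|/fI->//] := ltngtP (f B) (f C); first by rewrite lt.
  by apply/negbTE; rewrite -leqNgt ltnW // lt.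
by rewrite ltnn.
Qed.

End Hooks.
End HooksOfOrder.

Lemma Phi_surj m rho (alpha : arcs m.+1) : Ptilde_c (rho, alpha) ->
  exists pi H, laminar_hooks pi H /\ Phi (pi, H) = (rho, alpha).
Proof.
move=> P; have [f [fI fgood falpha]] := good_order_exists P.
case: P => /= rhoP _ [asub _] _ _.
have [pi reading] := reading_order_exists f rhoP.
have [H [H1 H2 H3]] := order_hooks_exist rhoP fI fgood reading.
exists pi, H; split; first exact: (order_laminar rhoP fI fgood reading).
rewrite /Phi /= (order_color_partition rhoP fI fgood reading) //; congr pair.
apply/setP => -[B C]; rewrite inE /=.
rewrite (order_color_partition rhoP fI fgood reading) //.
have [cg|ncg] := boolP (crossing_graph rho B C).
  have /and4P[Br Cr _ _] := cg.
  by rewrite falpha // (order_min_hat rhoP fI fgood reading H1).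
by apply/esym/negbTE; apply: contra ncg; apply: asub.
Qed.

(* n = m.+1 ranges over the integers n >= 1. *)
Theorem theorem5p3 (R : realType) (m : nat) :
  set_bij (@VHCS R m) (@Ptilde_c m) (@Phi m).
Proof.
split.
- by move=> [pi H] /VHC_laminar; apply: Phi_Ptilde.
- move=> [pi H] [sigma K]; rewrite !inE => /VHC_laminar lH /VHC_laminar lK.
  exact: Phi_inj.
- move=> [rho alpha] /Phi_surj[pi [H [lH e]]]; exists (pi, H) => //.
  exact/VHC_laminar.
Qed.
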